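(* Let $0<d<n$ be integers. There exist $\varepsilon_0>0$ and $C\ge1$, depending only on $n$ and $d$, such that the following holds for $0<\varepsilon\le\varepsilon_0$. Let $E,U\subset\mathbb{R}^n$ and let $\Sigma_0\subset\mathbb{R}^n$ be an $\varepsilon$-flat model surface. Assume that $$\mathrm{dist}(x,\Sigma_0)\le\varepsilon\ \text{ for }x\in E\cap U^+\quad\text{and}\quad\mathrm{dist}(x,E)\le1/2\ \text{ for }x\in\Sigma_0\cap U^+,$$ and that for every $x\in E\cap U^+$ and $r\in(0,1]$ there is an affine $d$-plane $P=P(x,r)$ through $x$ such that $$\mathrm{dist}(y,P)\le\varepsilon r\ \text{ for }y\in E\cap B(x,110r)\quad\text{and}\quad\mathrm{dist}(y,E)\le\varepsilon r\ \text{ for }y\in P\cap B(x,110r).$$ Then there is a bijective mapping $g:\mathbb{R}^n\to\mathbb{R}^n$ such that $$g(x)=x\ \text{ when }\mathrm{dist}(x,U)\ge13,$$ $$|g(x)-x|\le C\varepsilon\ \text{ for }x\in\mathbb{R}^n,$$ $$\tfrac14|x'-x|^{1+C\varepsilon}\le|g(x')-g(x)|\le3|x'-x|^{1-C\varepsilon}\ \text{ for }x,x'\in\mathbb{R}^n\text{ with }|x'-x|\le1,$$ and $$\overline E\cap U=g(\Sigma_0)\cap U.$$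
   Context: $U^+=\{x\in\mathbb{R}^n:\mathrm{dist}(x,U)\le2\}$. An ''$\varepsilon$-flat model surface'' means a smooth $d$-dimensional manifold $\Sigma_0\subset\mathbb{R}^n$ such that for every $x\in\Sigma_0$ there are an affine $d$-plane $P_x$ through $x$ and a $C^2$ function $F_x:P_x\to P_x^\perp$ (where $P_x^\perp$ is the $(n-d)$-dimensional vector space orthogonal to $P_x$) such that $|F_x(y)|+|DF_x(y)|+|D^2F_x(y)|\le\varepsilon$ for $y\in P_x$, and $\Sigma_0\cap B(x,200)=\{y+F_x(y):y\in P_x\}\cap B(x,200)$. *)

(* Defs.v *)
From HB Require Import structures.
From mathcomp Require Import all_boot all_order all_algebra.
From mathcomp Require Import all_classical all_reals all_analysis.
Set Implicit Arguments.
Unset Strict Implicit.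
Unset Printing Implicit Defensive.
Import Order.TTheory GRing.Theory Num.Theory.
Import numFieldNormedType.Exports.
Local Open Scope classical_set_scope.
Local Open Scope ring_scope.

(* R^n is 'rV[R]_n.  The library norm `|x| and the balls [ball x r] on it are
   those of the sup norm, hence the Euclidean versions below; the library
   topology (open, closure, continuity, derivatives) is the usual one. *)

Definition dot (R : realType) (n : nat) (u v : 'rV[R]_n) : R :=
  \sum_i u ord0 i * v ord0 i.

Definition enorm (R : realType) (n : nat) (u : 'rV[R]_n) : R :=
  Num.sqrt (dot u u).

Definition eball (R : realType) (n : nat) (x : 'rV[R]_n) (r : R)
    : set 'rV[R]_n :=
  [set y | enorm (y - x) < r].

(* Extended-real valued, so that the distance to the empty set is +oo. *)
Definition dist (R : realType) (n : nat) (x : 'rV[R]_n) (A : set 'rV[R]_n)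
    : \bar R :=
  ereal_inf [set (enorm (x - a))%:E | a in A].

Definition Uplus (R : realType) (n : nat) (U : set 'rV[R]_n) : set 'rV[R]_n :=
  [set x | (dist x U <= 2%:E)%E].

(* The affine plane x + V; it is a d-plane when \dim V = d. *)
Definition plane (R : realType) (n : nat) (x : 'rV[R]_n)
    (V : {vspace 'rV[R]_n}) : set 'rV[R]_n :=
  [set y | y - x \in V].

(* f is of class C^k on A, for differentiation in the directions of V only:
   all iterated directional derivatives of order <= k along vectors of V exist
   and are continuous on A.  It is meant to be used when A is an open set and
   V = fullv, or when A is an affine plane of direction V.  In the latter case
   the derivatives at points of A only involve the values of f on A, so that f
   can be regarded as a function defined on A. *)
Fixpoint Ck_on (R : realType) (n k : nat) (V : {vspace 'rV[R]_n})
    (A : set 'rV[R]_n) (f : 'rV[R]_n -> 'rV[R]_n) {struct k} : Prop :=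
  match k with
  | 0%N => {within A, continuous f}
  | k'.+1 => {within A, continuous f} /\
      forall v, v \in V ->
        (forall x, A x -> derivable f x v) /\ Ck_on k' V A ('D_v f)
  end.

Definition smooth_on (R : realType) (n : nat) (A : set 'rV[R]_n)
    (f : 'rV[R]_n -> 'rV[R]_n) : Prop :=
  forall k, Ck_on k fullv A f.

(* Embedded C^oo submanifold of dimension d: locally, a smooth diffeomorphism
   phi (with inverse psi) between open sets O and W of R^n maps S onto the
   d-dimensional coordinate plane. *)
Definition smooth_submanifold (R : realType) (n d : nat) (S : set 'rV[R]_n)
    : Prop :=
  forall x, S x ->
    exists (O W : set 'rV[R]_n) (phi psi : 'rV[R]_n -> 'rV[R]_n),
      [/\ open O, O x & open W] /\
      [/\ smooth_on O phi, smooth_on W psi,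
          phi @` O = W,
          {in O, cancel phi psi}
        & phi @` (S `&` O) =
          W `&` [set z | forall i : 'I_n, (d <= i)%N -> z ord0 i = 0]].

Local Open Scope ereal_scope.

(* Operator norms of DF(y) : V -> R^n and of D^2F(y) : V x V -> R^n, where
   DF(y) v = 'D_v F y and D^2F(y)(v, w) = 'D_w ('D_v F) y. *)
Definition normD1 (R : realType) (n : nat) (V : {vspace 'rV[R]_n})
    (F : 'rV[R]_n -> 'rV[R]_n) (y : 'rV[R]_n) : \bar R :=
  ereal_sup [set (enorm ('D_v F y))%:E
            | v in [set v | v \in V /\ (enorm v <= 1)%R]].

Definition normD2 (R : realType) (n : nat) (V : {vspace 'rV[R]_n})
    (F : 'rV[R]_n -> 'rV[R]_n) (y : 'rV[R]_n) : \bar R :=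
  ereal_sup [set (enorm ('D_(p.2) ('D_(p.1) F) y))%:E
            | p in [set v | v \in V /\ (enorm v <= 1)%R] `*`
                   [set v | v \in V /\ (enorm v <= 1)%R]].

Local Close Scope ereal_scope.

Definition flat_model_surface (R : realType) (n d : nat) (eps : R)
    (S : set 'rV[R]_n) : Prop :=
  smooth_submanifold d S /\
  forall x, S x ->
    exists (V : {vspace 'rV[R]_n}) (F : 'rV[R]_n -> 'rV[R]_n),
      [/\ \dim V = d,
          forall y, plane x V y -> forall v, v \in V -> dot (F y) v = 0,
          Ck_on 2 V (plane x V) F,
          forall y, plane x V y ->
            ((enorm (F y))%:E + normD1 V F y + normD2 V F y <= eps%:E)%E
        & S `&` eball x 200 =
          [set y + F y | y in plane x V] `&` eball x 200].

(* Main.v *)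
Require Import Defs.
From HB Require Import structures.
From mathcomp Require Import all_boot all_order all_algebra.
From mathcomp Require Import all_classical all_reals all_analysis.
From mathcomp Require Import ring lra zify.
Set Implicit Arguments.
Unset Strict Implicit.
Unset Printing Implicit Defensive.
Import Order.TTheory GRing.Theory Num.Theory.
Import numFieldNormedType.Exports.
Local Open Scope classical_set_scope.
Local Open Scope ring_scope.

(* The map g is the limit of compositions of maps id + v_k, where v_k is eta-Lipschitz and
   bounded by eta r_k, with eta = C eps and r_k = 2^-k / 20.  Any such limit is a bijection that
   moves points by O(eta) and is biHoelder with exponents 1 +- O(eta).  It remains to choose v_k
   so that the image S_k of Sigma0 after k steps stays O(eps r_k)-close to E near U, has slope
   O(eps) at scales <= r_k and has no holes.  Given S_k, project each point of S_k to the planes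
   P(z, r_k) of nearby points z of E and average the projections with a partition of unity at
   scale r_k: this defines v_k on the part of S_k near U.  Since the planes are O(eps)-close to
   each other, the slope and the distance to E of the averaged surface are bounded independently
   of those of S_k, so the errors do not accumulate.  Away from U set v_k = 0, and extend by
   McShane's formula: no regularity of v_k off S_k is needed. *)

(** * Euclidean norm *)

(** Being close to [E] does not prevent the image of [Sigma0] from missing part of [E]. No degree
    argument is used: the absence of holes is carried along as a quantitative condition, namely that
    from a point of the surface one can advance in any tangential direction with an error of at most
    half the displacement. So weak a condition survives a change of plane and a map [id + v_k], and
    it improves itself by iteration, so its constant does not degrade from scale to scale. The
    conditions at scale [r] are required within [10 r] of [U]. Halving [r] leaves room for the
    points that one step uses, and the layer between [9 r] and [10 r] serves to cut [v_k] off. The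
    choice [r_0 = 1/20] gives [10 r_0 = 1/2]: since [Sigma0] is only within 1/2 of [E], the points
    of [E] that the first stage needs are still within 2 of [U], where [E] is flat. Extensions and
    limits are taken coordinate by coordinate; each costs a factor [n], which explains the powers of
    [n] in the final constants. *)

Section Euclidean.
Variables (R : realType) (n : nat).
Implicit Types (u v w : 'rV[R]_n) (a b : R).

Lemma dotC u v : dot u v = dot v u.
Proof. by apply: eq_bigr => i _; rewrite mulrC. Qed.

Lemma dotDl u v w : dot (u + v) w = dot u w + dot v w.
Proof. by rewrite -big_split; apply: eq_bigr => i _; rewrite mxE mulrDl. Qed.

Lemma dotZl a u w : dot (a *: u) w = a * dot u w.
Proof. by rewrite mulr_sumr; apply: eq_bigr => i _; rewrite mxE mulrA. Qed.

Lemma dotDr u v w : dot w (u + v) = dot w u + dot w v.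
Proof. by rewrite dotC dotDl !(dotC w). Qed.

Lemma dotZr a u w : dot w (a *: u) = a * dot w u.
Proof. by rewrite dotC dotZl (dotC w). Qed.

Lemma dotNl u w : dot (- u) w = - dot u w.
Proof. by rewrite -scaleN1r dotZl mulN1r. Qed.

Lemma dotNr u w : dot w (- u) = - dot w u.
Proof. by rewrite dotC dotNl dotC. Qed.

Lemma dotBl u v w : dot (u - v) w = dot u w - dot v w.
Proof. by rewrite dotDl dotNl. Qed.

Lemma dotBr u v w : dot w (u - v) = dot w u - dot w v.
Proof. by rewrite dotDr dotNr. Qed.

Lemma dotuu_ge0 u : 0 <= dot u u.
Proof. by apply: sumr_ge0 => i _; rewrite -expr2 sqr_ge0. Qed.

Lemma enorm_ge0 u : 0 <= enorm u.
Proof. exact: sqrtr_ge0. Qed.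
Hint Resolve enorm_ge0 : core.

Lemma enorm_sqr u : enorm u ^+ 2 = dot u u.
Proof. by rewrite sqr_sqrtr // dotuu_ge0. Qed.

Lemma enorm0 : enorm (0 : 'rV[R]_n) = 0.
Proof.
by rewrite /enorm /dot big1 ?sqrtr0 // => i _; rewrite mxE mul0r.
Qed.

Lemma enormZ a u : enorm (a *: u) = `|a| * enorm u.
Proof.
by rewrite /enorm dotZl dotZr mulrA -expr2 sqrtrM ?sqr_ge0// sqrtr_sqr.
Qed.

Lemma enormN u : enorm (- u) = enorm u.
Proof. by rewrite -scaleN1r enormZ normrN1 mul1r. Qed.

Lemma enormBC u v : enorm (u - v) = enorm (v - u).
Proof. by rewrite -enormN opprB. Qed.

Lemma le_coord_enorm u i : `|u ord0 i| <= enorm u.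
Proof.
rewrite -(@ler_pXn2r _ 2) ?nnegrE // enorm_sqr real_normK ?num_real //.
rewrite /dot (bigD1 i) //= -expr2 lerDl.
by apply: sumr_ge0 => j _; rewrite -expr2 sqr_ge0.
Qed.

Lemma enorm_eq0 u : enorm u = 0 -> u = 0.
Proof.
move=> u0; apply/rowP => i; rewrite mxE; apply/eqP; rewrite -normr_le0 -u0.
exact: le_coord_enorm.
Qed.

Lemma dot_le_enorm u v : dot u v <= enorm u * enorm v.
Proof.
have [v0|v0] := eqVneq (enorm v) 0.
  rewrite (enorm_eq0 v0) enorm0 mulr0 -(scale0r (0 : 'rV[R]_n)) dotZr.
  by rewrite mul0r.
have pv : 0 < enorm v by rewrite lt_neqAle eq_sym v0 enorm_ge0.
have ab : 0 <= enorm u * enorm v by rewrite mulr_ge0.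
have := dotuu_ge0 (enorm v ^+ 2 *: u - dot u v *: v).
rewrite dotBl !dotBr !dotZl !dotZr (dotC v u) -!enorm_sqr.
move: ab; move: (dot u v) (enorm u) (enorm v) pv => x a b pb ab H.
have {}H : x ^+ 2 <= (a * b) ^+ 2.
  have pb2 : 0 < b ^+ 2 by rewrite exprn_gt0.
  rewrite -(ler_pM2l pb2); lra.
have [x0|x0] := ltP x 0; first by lra.
by rewrite -(@ler_pXn2r _ 2) ?nnegrE.
Qed.

Lemma ler_enormD u v : enorm (u + v) <= enorm u + enorm v.
Proof.
rewrite -(@ler_pXn2r _ 2) ?nnegrE ?addr_ge0// enorm_sqr.
rewrite dotDl !dotDr (dotC v u) -!enorm_sqr.
have := dot_le_enorm u v; lra.
Qed.

Lemma ler_enormB u v : enorm (u - v) <= enorm u + enorm v.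
Proof. by rewrite -(enormN v) ler_enormD. Qed.

Lemma lerB_enorm u v : enorm u - enorm v <= enorm (u - v).
Proof. by rewrite lerBlDr; have := ler_enormD (u - v) v; rewrite subrK. Qed.

Lemma enorm_triangle u v w : enorm (u - w) <= enorm (u - v) + enorm (v - w).
Proof. by rewrite -[u - w](subrKA v) ler_enormD. Qed.

Lemma ler_enorm_sum (I : finType) (F : I -> 'rV[R]_n) :
  enorm (\sum_i F i) <= \sum_i enorm (F i).
Proof.
elim/big_ind2: _ => [|x1 x2 y1 y2 h1 h2|//]; first by rewrite enorm0.
by apply: le_trans (ler_enormD _ _) _; rewrite lerD.
Qed.

Lemma enorm_le_sum u : enorm u <= \sum_i `|u ord0 i|.
Proof.
have ps : 0 <= \sum_i `|u ord0 i| by apply: sumr_ge0.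
rewrite -(@ler_pXn2r _ 2) ?nnegrE // enorm_sqr expr2 mulr_suml.
apply: ler_sum => i _; apply: le_trans (ler_norm _) _; rewrite normrM.
by rewrite ler_wpM2l // (bigD1 i) //= lerDl; apply: sumr_ge0.
Qed.

Lemma enorm_le_coord u b : (forall i, `|u ord0 i| <= b) -> enorm u <= n%:R * b.
Proof.
move=> h; apply: le_trans (enorm_le_sum u) _.
apply: (@le_trans _ _ (\sum_(i < n) b)); first exact: ler_sum.
by rewrite sumr_const card_ord mulr_natl.
Qed.

End Euclidean.
#[global] Hint Extern 0 (is_true (_ <= enorm _)) => exact: enorm_ge0 : core.

(** * Orthogonal projections *)

Ltac vec := apply/rowP => ?; rewrite !mxE; ring.

(** Planes are handled through the orthogonal projection on their direction: the distance from [y]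
    to the plane through [z] is the norm of [u - p u] with [u = y - z]. Subspaces return only when
    dimensions are compared. *)
Record oproj (R : realType) (n : nat) := OProj {
  oproj_fun :> {linear 'rV[R]_n -> 'rV[R]_n};
  oprojK : forall u, oproj_fun (oproj_fun u) = oproj_fun u;
  oproj_sym : forall u v, dot (oproj_fun u) v = dot u (oproj_fun v) }.

Section Projections.
Variables (R : realType) (n : nat).
Implicit Types (p q : oproj R n) (u v w : 'rV[R]_n) (V : {vspace 'rV[R]_n}).

Lemma oproj_contract p u : enorm (p u) <= enorm u.
Proof.
have [->|h] := eqVneq (enorm (p u)) 0; first exact: enorm_ge0.
have h0 : 0 < enorm (p u) by rewrite lt_neqAle eq_sym h enorm_ge0.
rewrite -(ler_pM2r h0) -expr2 enorm_sqr oproj_sym oprojK.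
exact: dot_le_enorm.
Qed.

Lemma oproj_pythagoras p u :
  enorm u ^+ 2 = enorm (p u) ^+ 2 + enorm (u - p u) ^+ 2.
Proof.
rewrite !enorm_sqr !(dotBl, dotBr) !(oproj_sym, oprojK) (dotC u (p u)).
rewrite oproj_sym; ring.
Qed.

Lemma oproj_res_contract p u : enorm (u - p u) <= enorm u.
Proof.
rewrite -(@ler_pXn2r _ 2) ?nnegrE // (oproj_pythagoras p u) lerDr.
exact: sqr_ge0.
Qed.

Lemma oproj_res_le p u v : enorm (u - p u) <= enorm (v - p v) + enorm (u - v).
Proof.
have -> : u - p u = (v - p v) + ((u - v) - p (u - v)).
  by rewrite linearB; vec.
by apply: le_trans (ler_enormD _ _) _; rewrite lerD2l oproj_res_contract.
Qed.

Lemma oproj_best p u v : p v = v -> enorm (u - p u) <= enorm (u - v).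
Proof. by move=> pv; have := oproj_res_le p u v; rewrite pv subrr enorm0 add0r. Qed.

(** The one-sided gap from the range of [p] to the range of [q]; it is not symmetric in general. *)
Definition oproj_le (k : R) p q := forall u, enorm (p u - q (p u)) <= k * enorm (p u).

(** By homogeneity one length [t] suffices. Flatness at a given scale only informs about vectors of
    comparable length. *)
Lemma oproj_le_scale (k t : R) p q : 0 < t ->
  (forall u, p u = u -> enorm u = t -> enorm (u - q u) <= k * t) -> oproj_le k p q.
Proof.
move=> t0 h u; have [e0|e0] := eqVneq (enorm (p u)) 0.
  by rewrite e0 (enorm_eq0 e0) linear0 subrr enorm0 mulr0.
have e1 : 0 < enorm (p u) by rewrite lt_neqAle eq_sym e0 enorm_ge0.
set a := t / enorm (p u).
have a0 : 0 < a by rewrite divr_gt0.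
have at_ : a * enorm (p u) = t by rewrite divfK.
have := h (a *: p u); rewrite !linearZ /= oprojK enormZ gtr0_norm // at_.
move=> /(_ erefl erefl).
rewrite -scalerDr enormZ gtr0_norm // -at_ mulrCA.
by rewrite ler_pM2l.
Qed.

(* [p - q = (1 - q) p - q (1 - p)], and the adjoint of [q (1 - p)] is [(1 - p) q]: the two one-sided
   gaps control [p - q]. *)
Lemma oproj_dist (k l : R) p q : 0 <= k -> 0 <= l ->
  oproj_le k p q -> oproj_le l q p ->
  forall u, enorm (p u - q u) <= (k + l) * enorm u.
Proof.
move=> k0 l0 kpq lqp u.
have -> : p u - q u = (p u - q (p u)) - q (u - p u) by rewrite linearB; vec.
apply: le_trans (ler_enormB _ _) _; rewrite mulrDl; apply: lerD.
  by apply: le_trans (kpq u) _; rewrite ler_wpM2l // oproj_contract.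
set w := q (u - p u).
have H : enorm w ^+ 2 <= l * enorm u * enorm w.
  rewrite enorm_sqr {1}/w oproj_sym.
  have -> : q w = w by rewrite /w oprojK.
  have -> : dot (u - p u) w = dot u (w - p w).
    by rewrite dotBl dotBr oproj_sym.
  apply: le_trans (dot_le_enorm _ _) _; rewrite -mulrA mulrCA ler_wpM2l //.
  by have := lqp (u - p u); rewrite -/w.
have [->|e0] := eqVneq (enorm w) 0; first by rewrite mulr_ge0.
have e1 : 0 < enorm w by rewrite lt_neqAle eq_sym e0 enorm_ge0.
by rewrite -(ler_pM2r e1) -expr2.
Qed.

Definition oproj_on p V := (forall u, p u \in V) /\ (forall u, u \in V -> p u = u).

(** If the rows of [A] form a basis of [V], the projection is right multiplication by [A^T G^-1 A]
    with the Gram matrix [G = A A^T], which is invertible because [c G = 0] forces the norm of [c A]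
    to vanish. *)
Lemma oproj_exists V : exists p, oproj_on p V.
Proof.
pose X := vbasis V; pose A : 'M[R]_(\dim V, n) := \matrix_i X`_i.
have AV (c : 'rV_(\dim V)) : c *m A \in V.
  rewrite mulmx_sum_row; apply: memv_suml => i _; apply: memvZ.
  by rewrite rowK; apply: vbasis_mem; rewrite mem_nth // size_tuple.
have VA u : u \in V -> exists c : 'rV_(\dim V), u = c *m A.
  move=> uV; exists (\row_i coord X i u); rewrite mulmx_sum_row.
  rewrite {1}(coord_vbasis uV); apply: eq_bigr => i _.
  by rewrite rowK mxE.
have dotE u v : u *m v^T = (dot u v)%:M.
  apply/matrixP => i j; rewrite !mxE !ord1 eqxx mulr1n.
  by apply: eq_bigr => k _; rewrite mxE.
have freeA (c : 'rV_(\dim V)) : c *m A = 0 -> c = 0.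
  move=> cA; apply/rowP => i; rewrite mxE.
  have /freeP := basis_free (vbasisP V); apply.
  transitivity (c *m A) => //; rewrite mulmx_sum_row.
  by apply: eq_bigr => j _; rewrite rowK.
pose G := A *m A^T.
have uG : G \in unitmx.
  rewrite -row_free_unit -kermx_eq0; apply/eqP/row_matrixP => i.
  set c := row i _; rewrite row0; apply: freeA; apply: enorm_eq0.
  have cG : c *m G = 0 by rewrite /c -row_mul mulmx_ker row0.
  apply/eqP; rewrite -sqrf_eq0 enorm_sqr.
  have : (dot (c *m A) (c *m A))%:M = 0 :> 'M[R]_1.
    by rewrite -dotE trmx_mul mulmxA -(mulmxA c) cG mul0mx.
  by move=> /matrixP /(_ ord0 ord0); rewrite !mxE eqxx mulr1n => ->.
pose M := A^T *m invmx G *m A.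
have symM : M^T = M.
  by rewrite /M !trmx_mul trmxK trmx_inv /G trmx_mul trmxK mulmxA.
have idM u : u \in V -> u *m M = u.
  move=> /VA[c ->]; rewrite /M !mulmxA -(mulmxA c) -/G.
  by rewrite -(mulmxA c) mulmxV // mulmx1.
have MV u : u *m M \in V by rewrite /M mulmxA AV.
have pK u : mulmxr M (mulmxr M u) = mulmxr M u by exact: (idM _ (MV u)).
have pS u v : dot (mulmxr M u) v = dot u (mulmxr M v).
  have : (dot (u *m M) v)%:M = (dot u (v *m M))%:M :> 'M[R]_1.
    by rewrite -!dotE trmx_mul symM -(mulmxA u).
  by move=> /matrixP /(_ ord0 ord0); rewrite !mxE eqxx !mulr1n.
by exists (OProj pK pS); split=> u /=; [exact: MV|exact: idM].
Qed.

(** Since [k < 1], [q] is injective on [V], hence onto [W] by equality of dimensions. So [q u = q v]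
    with [v] in [V] of norm at most twice that of [q u], and [v] is a competitor for the distance
    from [q u] to [V]. *)
Lemma oproj_le_sym (k : R) p q V W : oproj_on p V -> oproj_on q W ->
  \dim V = \dim W -> 0 <= k -> k <= 1 / 2 -> oproj_le k p q -> oproj_le (2 * k) q p.
Proof.
move=> pV qW dVW k0 k2 kpq u.
have near v : v \in V -> enorm (v - q v) <= k * enorm v.
  by move=> vV; have := kpq v; rewrite (pV.2).
pose f : 'Hom('rV[R]_n, 'rV[R]_n) := linfun q.
have fE v : f v = q v by rewrite lfunE.
have inj : (V :&: lker f)%VS = 0%VS.
  apply/eqP; rewrite -subv0; apply/subvP => v; rewrite memv_cap => /andP[vV].
  rewrite memv_ker fE => /eqP qv; rewrite memv0; apply/eqP/enorm_eq0.
  have := near v vV; rewrite qv subr0; have := enorm_ge0 v.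
  move: (enorm v) => e e0 h; nra.
have sub : (f @: V <= W)%VS.
  by apply/subvP => w /memv_imgP[v _ ->]; rewrite fE (qW.1).
have img : (f @: V)%VS = W.
  by apply/eqP; rewrite eqEdim sub (limg_dim_eq inj) dVW leqnn.
have := qW.1 u; rewrite -img => /memv_imgP[v vV]; rewrite fE => quE.
have h1 := near v vV.
have h2 : enorm v <= enorm (q u) + k * enorm v.
  have := ler_enormD (v - q v) (q v); rewrite subrK quE; lra.
have h3 := oproj_best (q u) ((pV.2) v vV).
have h4 : enorm (q u - v) = enorm (v - q v) by rewrite quE enormBC.
have h5 : enorm v <= 2 * enorm (q u).
  have : k * enorm v <= 1 / 2 * enorm v by rewrite ler_wpM2r.
  lra.
have : k * enorm v <= k * (2 * enorm (q u)) by rewrite ler_wpM2l.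
lra.
Qed.

End Projections.

(** * A partition of unity *)

Section Tents.
Variables (R : realType).
Implicit Types (b : bool) (t : R).

(* The point of [2Z + b] nearest to [t]. *)
Definition tent_center b t : R := 2 * (Num.floor ((t + 1 - b%:R) / 2))%:~R + b%:R.
Definition tent b t : R := 1 - `|t - tent_center b t|.

Lemma tent_centerP b t : -1 <= t - tent_center b t < 1.
Proof.
rewrite /tent_center; have /andP[] := Num.Theory.floor_itv ((t + 1 - b%:R) / 2).
rewrite intrD => h1 h2; apply/andP; split; lra.
Qed.

Lemma tent_ge0 b t : 0 <= tent b t.
Proof.
have /andP[h1 h2] := tent_centerP b t.
by rewrite subr_ge0 ler_norml h1 ltW.
Qed.

Lemma tent_le1 b t : tent b t <= 1.
Proof. by rewrite gerBl. Qed.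

Lemma tent_sum t : tent false t + tent true t = 1.
Proof.
rewrite /tent /tent_center /= subr0 addr0 addrK.
have /andP[] := Num.Theory.floor_itv ((t + 1) / 2).
have /andP[] := Num.Theory.floor_itv (t / 2).
set m := Num.floor (t / 2); set k := Num.floor ((t + 1) / 2).
rewrite !intrD => h1 h2 h3 h4.
(* The centres [2k] and [2m + 1] are consecutive integers enclosing [t]. *)
have km : k = m \/ k = m + 1.
  have mk : m < k + 1 by rewrite -(ltr_int R) intrD; lra.
  have km : k < m + 2.
    by rewrite -(ltr_int R) intrD; lra.
  lia.
case: km => e; rewrite e ?intrD in h3 h4 *; move: (m%:~R : R) h1 h2 h3 h4 => x h1 h2 h3 h4.
  rewrite ger0_norm; last by lra.
  rewrite ler0_norm; lra.
rewrite ler0_norm; last by lra.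
rewrite ger0_norm; lra.
Qed.

Lemma tent_lip b t t' : tent_center b t = tent_center b t' ->
  `|tent b t - tent b t'| <= `|t - t'|.
Proof.
rewrite /tent => ->; set c := tent_center b t'.
have := ler_dist_dist (t' - c) (t - c).
have -> : t' - c - (t - c) = t' - t by ring.
rewrite (distrC t' t); congr (_ <= _); congr `| _ |; ring.
Qed.

(** A cell wall separates the two points; the tent vanishes there and has slope one. *)
Lemma tent_jump b t t' : tent_center b t != tent_center b t' ->
  tent b t <= `|t - t'|.
Proof.
move=> ne; rewrite /tent.
have /andP[] := tent_centerP b t; have /andP[] := tent_centerP b t'.
move: ne; rewrite /tent_center.
set m := Num.floor ((t + 1 - b%:R) / 2); set k := Num.floor ((t' + 1 - b%:R) / 2).
move=> ne h1 h2 h3 h4.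
have {ne} : k < m \/ m < k.
  by apply/orP; rewrite -neq_lt eq_sym; apply: contraNneq ne => ->.
have lt1 (i j : int) : i < j -> (i%:~R + 1 <= j%:~R :> R).
  by move=> ij; rewrite -(intrD _ _ 1) ler_int lezD1.
set x := (t - _); have := ler_norm x; have := ler_norm (- x); rewrite normrN.
have := ler_norm (t - t'); have := ler_norm (t' - t); rewrite (distrC t').
by rewrite /x => g1 g2 g3 g4 [/lt1|/lt1] g5; lra.
Qed.

End Tents.

Section PartitionOfUnity.
Variables (R : realType).

Lemma dist_prod_le (I : finType) (a b : I -> R) :
  (forall i, 0 <= a i <= 1) -> (forall i, 0 <= b i <= 1) ->
  `|\prod_i a i - \prod_i b i| <= \sum_i `|a i - b i|.
Proof.
move=> ha hb.
(* The telescoping step needs the partial products to stay in [[0, 1]], so this joins the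
   induction. *)
suff [] : [/\ 0 <= \prod_i a i <= 1, 0 <= \prod_i b i <= 1 &
  `|\prod_i a i - \prod_i b i| <= \sum_i `|a i - b i|] by [].
elim/big_rec3: _ => [|i S B A _ [/andP[A0 A1] /andP[B0 B1] h]].
  by rewrite subrr normr0 lexx ler01.
have /andP[a0 a1] := ha i; have /andP[b0 b1] := hb i.
split; rewrite ?mulr_ge0 ?mulr_ile1 //.
have -> : a i * A - b i * B = (a i - b i) * A + b i * (A - B) by ring.
apply: le_trans (ler_normD _ _) _; rewrite !normrM (ger0_norm A0) (ger0_norm b0).
apply: lerD; first by rewrite ler_piMr.
by apply: le_trans h; rewrite ler_piMl.
Qed.

Lemma prod_le_factor (I : finType) (a : I -> R) j :
  (forall i, 0 <= a i <= 1) -> \prod_i a i <= a j.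
Proof.
move=> ha; rewrite (bigD1 j) //=; have /andP[a0 a1] := ha j.
by rewrite ler_piMr //; apply: prodr_ile1 => i _; exact: ha.
Qed.

(* The supports of the functions [theta c], for a fixed colour [c], are the cells of a grid;
   [ctr c y] is the centre of the cell of [y]. *)
Lemma partition_of_unity (n : nat) : (0 < n)%N ->
  exists (I : finType) (L : R), 0 <= L /\ forall r : R, 0 < r ->
  exists (theta : I -> 'rV[R]_n -> R) (ctr : I -> 'rV[R]_n -> 'rV[R]_n),
  [/\ forall c y, 0 <= theta c y,
      forall y, \sum_c theta c y = 1,
      forall c y, enorm (ctr c y - y) <= r / 2 &
      forall c y y',
        ctr c y = ctr c y' /\ `|theta c y - theta c y'| <= L / r * enorm (y - y') \/
        theta c y <= L / r * enorm (y - y') /\ theta c y' <= L / r * enorm (y - y')].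
Proof.
(* A colour is a vector of parities. In [L], each coordinate contributes the inverse mesh [2 n / r],
   and the product has [n] factors. *)
move=> n0; exists {ffun 'I_n -> bool}, (2 * n%:R * n%:R); split=> [|r r0].
  by rewrite !mulr_ge0.
have nR : 0 < n%:R :> R by rewrite ltr0n.
have nR1 : 1 <= n%:R :> R by rewrite ler1n.
(* The mesh for which [n] coordinates, each off by at most [s], amount to [r / 2]. *)
pose s := r / (2 * n%:R).
have s0 : 0 < s by rewrite divr_gt0 ?mulr_gt0.
have sE : s^-1 = 2 * n%:R / r by rewrite /s invf_div.
pose theta (c : {ffun 'I_n -> bool}) (y : 'rV[R]_n) := \prod_i tent (c i) (y ord0 i / s).
pose ctr (c : {ffun 'I_n -> bool}) (y : 'rV[R]_n) :=
  \row_i (s * tent_center (c i) (y ord0 i / s)).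
have t01 (c : {ffun 'I_n -> bool}) (y : 'rV[R]_n) i : 0 <= tent (c i) (y ord0 i / s) <= 1.
  by rewrite tent_ge0 tent_le1.
have coord (y y' : 'rV[R]_n) i :
    `|y ord0 i / s - y' ord0 i / s| <= 2 * n%:R / r * enorm (y - y').
  rewrite -mulrBl normrM (@ger0_norm _ s^-1) ?invr_ge0 ?(ltW s0) // mulrC sE.
  rewrite ler_pM2l ?divr_gt0 ?mulr_gt0 //.
  by have := le_coord_enorm (y - y') i; rewrite !mxE.
have big (y y' : 'rV[R]_n) : 2 * n%:R / r * enorm (y - y') <=
    2 * n%:R * n%:R / r * enorm (y - y').
  apply: ler_wpM2r => //; apply: ler_wpM2r; first by rewrite invr_ge0 ltW.
  by rewrite ler_peMr // mulr_ge0.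
exists theta, ctr; split.
- by move=> c y; apply: prodr_ge0 => i _; exact: tent_ge0.
- move=> y; rewrite /theta.
  (* The sum over colours is the expanded product over coordinates of sums equal to one. *)
  rewrite -(bigA_distr_bigA (fun i b => tent b (y ord0 i / s))) big1 // => i _.
  by rewrite big_bool /= addrC tent_sum.
- move=> c y; apply: le_trans (_ : n%:R * s <= _); last first.
    by rewrite /s; rewrite le_eqVlt; apply/orP; left; apply/eqP; field; rewrite !gt_eqF.
  apply: enorm_le_coord => i; rewrite !mxE.
  have /andP[h1 h2] := tent_centerP (c i) (y ord0 i / s).
  have -> : s * tent_center (c i) (y ord0 i / s) - y ord0 i =
      s * (tent_center (c i) (y ord0 i / s) - y ord0 i / s).
    by rewrite mulrBr [s * (_ / _)]mulrC divfK // gt_eqF.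
  rewrite normrM gtr0_norm //.
  by rewrite ler_piMr ?(ltW s0) // distrC ler_norml h1 ltW.
- move=> c y y'.
  have [e|nec] := EM (ctr c y = ctr c y'); [left; split=> //|right].
    have ei i : tent_center (c i) (y ord0 i / s) = tent_center (c i) (y' ord0 i / s).
      move/rowP: e => /(_ i); rewrite !mxE => /mulfI; apply.
      by rewrite gt_eqF.
    rewrite /theta; apply: le_trans (dist_prod_le (t01 c y) (t01 c y')) _.
    apply: (@le_trans _ _ (\sum_(i < n) (2 * n%:R / r * enorm (y - y')))).
      by apply: ler_sum => i _; apply: le_trans (tent_lip (ei i)) (coord _ _ _).
    rewrite sumr_const card_ord -mulr_natl; rewrite le_eqVlt; apply/orP; left; apply/eqP; ring.
  (* The centres differ in some coordinate, and the tent of that coordinate alone bounds the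
     product. *)
  have /existsNP[i] : ~ forall i, ctr c y ord0 i = ctr c y' ord0 i.
    by move=> h; apply: nec; apply/rowP.
  rewrite !mxE => ne.
  have {}ne : tent_center (c i) (y ord0 i / s) != tent_center (c i) (y' ord0 i / s).
    by apply: contra_notN ne => /eqP ->.
  have h1 := tent_jump ne; rewrite eq_sym in ne; have h2 := tent_jump ne.
  have p1 := prod_le_factor i (t01 c y); have p2 := prod_le_factor i (t01 c y').
  split.
    by apply: le_trans p1 _; apply: le_trans h1 _; apply: le_trans (coord _ _ _) (big _ _).
  apply: le_trans p2 _; apply: le_trans h2 _; rewrite distrC.
  by apply: le_trans (coord _ _ _) (big _ _).
Qed.

End PartitionOfUnity.

(** * Limits of compositions of small perturbations of the identity *)

Section GeometricSequences.
Variables (R : realType).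

(** The form in which limits are passed to below: errors are bounded by geometric sequences in [k],
    and equalities follow by applying this to a norm. *)
Lemma le_geometric_le0 (x c q : R) : 0 <= q -> q < 1 ->
  (forall k, x <= c * q ^+ k) -> x <= 0.
Proof.
move=> q0 q1 h.
have cv : (fun k => c * q ^+ k) @ \oo --> (c * 0 : R).
  by apply: cvgMr; apply: cvg_expr; rewrite ger0_norm.
have e : limn (fun k => c * q ^+ k) = 0 by apply/cvg_lim => //; rewrite -[X in _ --> X](mulr0 c).
rewrite -e; apply: limr_ge; first by apply/cvg_ex; exists (c * 0).
by apply: nearW.
Qed.

(** With [c = A / (1 - q)], the intervals of centre [u k] and radius [c q^k] are nested; the limit
    is the supremum of their left ends. *)
Lemma real_geometric_limit (u : nat -> R) (A q : R) : 0 <= A -> 0 <= q -> q < 1 ->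
  (forall k, `|u k.+1 - u k| <= A * q ^+ k) ->
  exists l, forall k, `|u k - l| <= A / (1 - q) * q ^+ k.
Proof.
move=> A0 q0 q1 h; set c := A / (1 - q).
have q1' : 0 < 1 - q by rewrite subr_gt0.
have cA : A = c - c * q by rewrite -[A](divfK (lt0r_neq0 q1')) -/c; ring.
have stepE k : A * q ^+ k = c * q ^+ k - c * q ^+ k.+1 by rewrite exprS cA; ring.
have c0 : 0 <= c by rewrite divr_ge0 // ltW.
have cq k : 0 <= c * q ^+ k by rewrite mulr_ge0 // exprn_ge0.
have lo k m : u k - c * q ^+ k <= u (k + m)%N - c * q ^+ (k + m).
  elim: m => [|m IH]; first by rewrite addn0.
  rewrite addnS; apply: le_trans IH _; have := h (k + m)%N.
  rewrite ler_norml stepE; lra.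
have up k m : u (k + m)%N + c * q ^+ (k + m) <= u k + c * q ^+ k.
  elim: m => [|m IH]; first by rewrite addn0.
  rewrite addnS; apply: le_trans _ IH; have := h (k + m)%N.
  rewrite ler_norml stepE; lra.
pose S := range (fun k => u k - c * q ^+ k).
have ubS k : ubound S (u k + c * q ^+ k).
  move=> _ [m _ <-]; have := lo m k; have := up k m; rewrite addnC.
  have := cq (m + k)%N; lra.
have S0 : S !=set0 by exists (u 0%N - c * q ^+ 0); exists 0%N.
exists (sup S) => k; rewrite ler_norml; apply/andP; split.
  by rewrite lerBrDr addrC lerBlDr; apply: ge_sup => //; exact: ubS.
rewrite lerBlDr -lerBlDl; apply: sup_ubound; last by exists k.
by exists (u 0%N + c * q ^+ 0); exact: ubS.
Qed.

Lemma geometric_limit (n : nat) (u : nat -> 'rV[R]_n) (A q : R) :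
  0 <= A -> 0 <= q -> q < 1 ->
  (forall k, enorm (u k.+1 - u k) <= A * q ^+ k) ->
  exists l, forall k, enorm (u k - l) <= n%:R * (A / (1 - q) * q ^+ k).
Proof.
move=> A0 q0 q1 h.
have /choice[l lP] : forall i, exists l, forall k,
    `|u k ord0 i - l| <= A / (1 - q) * q ^+ k.
  move=> i; apply: real_geometric_limit => // k.
  by apply: le_trans (h k); have := le_coord_enorm (u k.+1 - u k) i; rewrite !mxE.
exists (\row_i l i) => k; apply: enorm_le_coord => i; rewrite !mxE; exact: lP.
Qed.

End GeometricSequences.

Section SmallLipschitzPerturbations.
Variables (R : realType) (n : nat).
Implicit Types (x y : 'rV[R]_n) (v : 'rV[R]_n -> 'rV[R]_n).

Definition lipschitz_by (eta : R) v := forall x y, enorm (v x - v y) <= eta * enorm (x - y).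

Lemma perturbation_lower eta v x y : lipschitz_by eta v ->
  (1 - eta) * enorm (x - y) <= enorm ((x + v x) - (y + v y)).
Proof.
move=> h; have := h x y; have := ler_enormB ((x + v x) - (y + v y)) (v x - v y).
have -> : x + v x - (y + v y) - (v x - v y) = x - y by vec.
lra.
Qed.

Lemma perturbation_upper eta v x y : lipschitz_by eta v ->
  enorm ((x + v x) - (y + v y)) <= (1 + eta) * enorm (x - y).
Proof.
move=> h; have := h x y; have := ler_enormD (x - y) (v x - v y).
have -> : x - y + (v x - v y) = x + v x - (y + v y) by vec.
lra.
Qed.

(** Picard iteration for the contraction that sends [x] to [y - v x]. *)
Lemma perturbation_surj eta v : 0 <= eta -> eta < 1 -> lipschitz_by eta v ->
  forall y, exists x, x + v x = y.
Proof.
move=> e0 e1 h y.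
pose u := fix u k := if k is k'.+1 then y - v (u k') else y.
have hu k : enorm (u k.+1 - u k) <= enorm (v y) * eta ^+ k.
  elim: k => [|k IH].
    by rewrite /= (_ : y - v y - y = - v y) ?enormN ?expr0 ?mulr1 //; vec.
  have -> : u k.+2 - u k.+1 = - (v (u k.+1) - v (u k)) by rewrite /=; vec.
  rewrite enormN exprS mulrCA; apply: le_trans (h _ _) _.
  by rewrite ler_wpM2l.
have [l lP] := geometric_limit (enorm_ge0 _) e0 e1 hu.
exists l; apply/eqP; rewrite -subr_eq0; apply/eqP/enorm_eq0/eqP.
rewrite eq_le enorm_ge0 andbT.
set c := n%:R * (enorm (v y) / (1 - eta)).
apply: (@le_geometric_le0 _ _ (2 * c) eta) => // k.
have h3 := h (u k) l.
have h1 : enorm (u k - l) <= c * eta ^+ k by rewrite -mulrA.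
have h2 : enorm (u k.+1 - l) <= eta * (c * eta ^+ k).
  by apply: le_trans (lP k.+1) _; rewrite exprS mulrA mulrCA.
have c0 : 0 <= c * eta ^+ k.
  by rewrite !mulr_ge0 ?invr_ge0 ?exprn_ge0 ?enorm_ge0 // subr_ge0 ltW.
have -> : l + v l - y = - (u k.+1 - l) - (v (u k) - v l) by rewrite /=; vec.
apply: le_trans (ler_enormB _ _) _; rewrite enormN.
have : eta * enorm (u k - l) <= 1 * (c * eta ^+ k).
  by apply: ler_pM => //; apply: ltW.
have : eta * (c * eta ^+ k) <= c * eta ^+ k by rewrite ler_piMl // ltW.
lra.
Qed.

End SmallLipschitzPerturbations.

(** * From accumulated distortion to Hölder exponents *)

Section Powers.
Variables (R : realType).
Implicit Types (eta t : R).

(** The constant 6 of the exponents comes from [ln (3/2) >= 1/3], itself a consequence of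
    [exp (-1/3) >= 2/3]. *)
Lemma powR_3_2_ge eta : 0 <= eta -> 1 + 2 * eta <= (3 / 2) `^ (6 * eta).
Proof.
move=> e0; have p : 0 < 3 / 2 :> R by lra.
have ln32 : 1 / 3 <= ln (3 / 2 : R).
  rewrite -(expRK (1 / 3)) ler_ln ?posrE ?expR_gt0 //.
  have := expR_ge1Dx (- (1 / 3) : R); rewrite expRN => h.
  have e : expR (1 / 3 : R) * (expR (1 / 3))^-1 = 1 by rewrite divff // gt_eqF ?expR_gt0.
  have : expR (1 / 3 : R) * (1 - 1 / 3) <= expR (1 / 3) * (expR (1 / 3))^-1.
    by rewrite ler_wpM2l // expR_ge0.
  rewrite e; lra.
rewrite /powR gt_eqF //; apply: le_trans (expR_ge1Dx _) _; rewrite ler_expR.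
have : 6 * eta * (1 / 3) <= 6 * eta * ln (3 / 2) by rewrite ler_wpM2l // mulr_ge0.
lra.
Qed.

(* [(3/2)^m < 1/t] bounds [m] by a multiple of [log (1/t)], so a factor [(1 +- eta)^m] costs only
   a small power of [t]. *)
Lemma powR_growth eta t m : 0 <= eta -> eta <= 1 / 100 -> 0 < t -> (3 / 2) ^+ m * t <= 1 ->
  (1 + eta) ^+ m * t <= t `^ (1 - 6 * eta) /\ t `^ (1 + 6 * eta) <= (1 - eta) ^+ m * t.
Proof.
move=> e0 e1 t0 mt; set Q := (t^-1) `^ (6 * eta).
have Q0 : 0 < Q by rewrite powR_gt0 // invr_gt0.
have PQ : ((3 / 2) `^ (6 * eta)) ^+ m <= Q.
  rewrite -powR_mulrn ?powR_ge0 // powRAC powR_mulrn; last by lra.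
  apply: ge0_ler_powR; rewrite ?nnegrE ?mulr_ge0 ?exprn_ge0 ?invr_ge0 ?(ltW t0) //.
  by rewrite -[leRHS]mul1r ler_pdivlMr.
have h := powR_3_2_ge e0.
have QE : Q = t `^ (- (6 * eta)).
  by rewrite /Q -(powR_inv1 (ltW t0)) -powRrM mulN1r.
have tn0 : t != 0 by rewrite gt_eqF.
have -> : t `^ (1 - 6 * eta) = Q * t.
  by rewrite powRD ?tn0 ?implybT // powRr1 ?ltW // QE mulrC.
have -> : t `^ (1 + 6 * eta) = Q^-1 * t.
  by rewrite powRD ?tn0 ?implybT // powRr1 ?ltW // QE powRN invrK mulrC.
rewrite !ler_pM2r //; split.
  by apply: le_trans PQ; apply: lerXn2r; rewrite ?nnegrE ?powR_ge0; lra.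
rewrite -[leLHS]mulr1 mulrC ler_pdivrMr //.
apply: le_trans (_ : (1 - eta) ^+ m * ((3 / 2) `^ (6 * eta)) ^+ m <= _).
  rewrite -exprMn; apply: exprn_ege1.
  (* For [eta <= 1/100], [(1 - eta) (1 + 2 eta) >= 1]: each factor of the power outweighs one factor
     [1 - eta]. *)
  have : (1 - eta) * (1 + 2 * eta) <= (1 - eta) * (3 / 2) `^ (6 * eta).
    by rewrite ler_wpM2l //; lra.
  nra.
by rewrite ler_wpM2l // exprn_ge0 //; lra.
Qed.

End Powers.

(** * The flow of perturbations and its limit *)

Section LimitOfPerturbations.
Variables (R : realType) (n : nat) (eta : R) (v : nat -> 'rV[R]_n -> 'rV[R]_n).

Fixpoint flow k x := if k is k'.+1 then flow k' x + v k' (flow k' x) else x.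

Definition stage_scale k : R := (1 / 2) ^+ k / 20.

Lemma stage_scale_gt0 k : 0 < stage_scale k.
Proof. by rewrite divr_gt0 // exprn_gt0. Qed.

Lemma stage_scaleS k : stage_scale k.+1 = stage_scale k / 2.
Proof. by rewrite /stage_scale exprS; field. Qed.

Lemma stage_scale_le k : stage_scale k <= 1 / 20.
Proof.
rewrite ler_pM2r ?invr_gt0 //; apply: exprn_ile1; lra.
Qed.

Hypotheses (n0 : (0 < n)%N) (eta0 : 0 <= eta) (neta : n%:R * eta <= 1 / 100).
Hypothesis (v_small : forall k x, enorm (v k x) <= eta * stage_scale k).
Hypothesis (v_lip : forall k, lipschitz_by eta (v k)).

Let n1 : 1 <= n%:R :> R. Proof. by rewrite ler1n. Qed.

Let eta1 : eta <= 1 / 100.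
Proof. by apply: le_trans neta; rewrite ler_peMl. Qed.

Lemma flow_lower k x y : (1 - eta) ^+ k * enorm (x - y) <= enorm (flow k x - flow k y).
Proof.
have e0 := eta0; have e1 := eta1.
elim: k => [|k IH] /=; first by rewrite expr0 mul1r.
apply: le_trans (perturbation_lower _ _ (v_lip k)); rewrite exprS -mulrA.
by rewrite ler_wpM2l //; lra.
Qed.

Lemma flow_upper k x y : enorm (flow k x - flow k y) <= (1 + eta) ^+ k * enorm (x - y).
Proof.
have e0 := eta0; have e1 := eta1.
elim: k => [|k IH] /=; first by rewrite expr0 mul1r.
apply: le_trans (perturbation_upper _ _ (v_lip k)) _; rewrite exprS -mulrA.
by rewrite ler_wpM2l //; lra.
Qed.

Lemma flow_surj k y : exists x, flow k x = y.
Proof.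
have e0 := eta0; have e1 := eta1.
have {}e1 : eta < 1 by lra.
elim: k y => [|k IH] y; first by exists y.
have [z <-] := perturbation_surj eta0 e1 (v_lip k) y.
by have [x <-] := IH z; exists x.
Qed.

Lemma limit_exists : exists g : 'rV[R]_n -> 'rV[R]_n,
  forall x k, enorm (flow k x - g x) <= n%:R * (2 * eta * stage_scale k).
Proof.
have e0 := eta0; have e1 := eta1.
suff /choice[g gP] : forall x : 'rV[R]_n, exists l : 'rV[R]_n, forall k,
    enorm (flow k x - l) <= n%:R * (2 * eta * stage_scale k) by exists g.
move=> x.
have [||||l lP] := @geometric_limit _ _ (flow ^~ x) (eta / 20) (1 / 2); try lra.
  move=> k /=; rewrite addrC addKr; apply: le_trans (v_small _ _) _.
  by rewrite /stage_scale mulrA mulrAC.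
exists l => k; apply: le_trans (lP k) _; rewrite le_eqVlt; apply/orP; left; apply/eqP.
by congr (_ * _); rewrite /stage_scale; field.
Qed.

Section Limit.
Variable g : 'rV[R]_n -> 'rV[R]_n.
Hypothesis gP : forall x k, enorm (flow k x - g x) <= n%:R * (2 * eta * stage_scale k).

Let close x k : enorm (flow k x - g x) <= 1 / 50 * stage_scale k.
Proof.
have e0 := eta0; have e1 := eta1.
apply: le_trans (gP x k) _; have := stage_scale_gt0 k => r0.
rewrite (_ : _ * _ = 2 * (n%:R * eta) * stage_scale k); last by ring.
have := neta; by rewrite ler_pM2r //; lra.
Qed.

Let dist_close x y k :
  `|enorm (g x - g y) - enorm (flow k x - flow k y)| <= 1 / 25 * stage_scale k.
Proof.
have e0 := eta0; have e1 := eta1.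
have h1 := close x k; have h2 := close y k.
have := ler_enormD (g x - flow k x) (flow k y - g y).
rewrite (enormBC (g x)) => h3.
have h4 := ler_enormD (flow k x - flow k y) (g x - flow k x + (flow k y - g y)).
have h5 := ler_enormD (g x - g y) (flow k x - g x + (g y - flow k y)).
have h6 := ler_enormD (flow k x - g x) (g y - flow k y).
rewrite (_ : _ + _ = g x - g y) in h4; last by vec.
rewrite (_ : _ + _ = flow k x - flow k y) in h5; last by vec.
rewrite (enormBC (g y)) in h6.
rewrite ler_norml; apply/andP; split; lra.
Qed.

(** The two points are followed until their distance [T k] reaches [2^-k]. The later steps change it
    by at most a small fraction of [2^-k], and the steps before are so few that their distortion is
    a small power of [t]. *)
Lemma limit_holder x y : enorm (x - y) <= 1 ->
  1 / 4 * enorm (x - y) `^ (1 + 6 * eta) <= enorm (g x - g y) /\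
  enorm (g x - g y) <= 3 * enorm (x - y) `^ (1 - 6 * eta).
Proof.
have e0 := eta0; have e1 := eta1.
set t := enorm (x - y) => t1.
have [t0|tn0] := eqVneq t 0.
  have -> : x = y by apply/eqP; rewrite -subr_eq0; apply/eqP/enorm_eq0.
  by rewrite t0 subrr enorm0 !powR0 ?mulr0 //; apply/eqP; lra.
have t0 : 0 < t by rewrite lt_neqAle eq_sym tn0 enorm_ge0.
pose T k := enorm (flow k x - flow k y).
(* Otherwise [(3/4)^k t <= T k < 2^-k] for all [k], that is, [t <= (2/3)^k]. *)
have exk : exists k, (1 / 2) ^+ k <= T k.
  apply: contrapT => /forallNP nk.
  have : t <= 0; last by lra.
  apply: (@le_geometric_le0 _ t 1 (2 / 3)); try lra.
  move=> k; have := nk k => /negP; rewrite -ltNge => hk.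
  have e3 : 0 < (3 / 4) ^+ k :> R by rewrite exprn_gt0 //; lra.
  rewrite -(ler_pM2l e3) mul1r -exprMn.
  have -> : 3 / 4 * (2 / 3) = 1 / 2 :> R by field.
  apply: le_trans (ltW hk); apply: le_trans (flow_lower k x y).
  rewrite -/t ler_pM2r //; apply: lerXn2r; rewrite ?nnegrE; lra.
case: (ex_minnP exk) => -[|m] hk mink.
  rewrite expr0 /T /= -/t in hk.
  have -> : t = 1 by apply/eqP; rewrite eq_le t1.
  rewrite !powR1; have := dist_close x y 0; rewrite /= -/t /stage_scale expr0 ler_norml.
  by move=> /andP[h1 h2]; split; lra.
have hm : T m < (1 / 2) ^+ m.
  by rewrite ltNge; apply/negP => /mink; rewrite ltnn.
(* By minimality, [(3/4)^m t <= T m < 2^-m]. *)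
have tm : (3 / 2) ^+ m * t <= 1.
  have e2 : 0 < (1 / 2) ^+ m :> R by rewrite exprn_gt0 //; lra.
  rewrite -(ler_pM2l e2) mulr1 mulrA -exprMn.
  have -> : 1 / 2 * (3 / 2) = 3 / 4 :> R by field.
  apply: le_trans (ltW hm); apply: le_trans (flow_lower m x y).
  rewrite -/t ler_pM2r //; apply: lerXn2r; rewrite ?nnegrE; lra.
have [up lo] := powR_growth eta0 eta1 t0 tm.
have := dist_close x y m.+1; rewrite /stage_scale ler_norml -/(T _) => /andP[d1 d2].
have lT : (1 - eta) ^+ m.+1 * t <= T m.+1 by exact: flow_lower.
have uT : T m.+1 <= (1 + eta) ^+ m.+1 * t by exact: flow_upper.
rewrite !exprS -!mulrA in lT uT.
have lo0 := powR_ge0 t (1 + 6 * eta).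
have up0 : 0 <= (1 + eta) ^+ m * t by rewrite mulr_ge0 ?exprn_ge0 //; lra.
have lo1 : 9 / 10 * ((1 - eta) ^+ m * t) <= (1 - eta) * ((1 - eta) ^+ m * t).
  by rewrite ler_wpM2r //; lra.
have up1 : (1 + eta) * ((1 + eta) ^+ m * t) <= 11 / 10 * ((1 + eta) ^+ m * t).
  by rewrite ler_wpM2r //; lra.
by split; lra.
Qed.

(** The flow shrinks distances by [(3/4)^k] at worst, whereas it is within [O(2^-k)] of [g]: the
    quotient [(2/3)^k] tends to zero. *)
Lemma limit_inj : injective g.
Proof.
have e0 := eta0; have e1 := eta1.
move=> x y gxy; apply/eqP; rewrite -subr_eq0; apply/eqP/enorm_eq0/eqP.
rewrite eq_le enorm_ge0 andbT.
apply: (@le_geometric_le0 _ _ 1 (2 / 3)); try lra.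
move=> k.
have e3 : 0 < (3 / 4) ^+ k :> R by rewrite exprn_gt0 //; lra.
rewrite -(ler_pM2l e3) mul1r -exprMn.
have -> : 3 / 4 * (2 / 3) = 1 / 2 :> R by field.
apply: (@le_trans _ _ (enorm (flow k x - flow k y))).
  apply: le_trans (flow_lower k x y).
  rewrite ler_wpM2r //; apply: lerXn2r; rewrite ?nnegrE; lra.
have := dist_close x y k; rewrite gxy subrr enorm0 sub0r normrN ger0_norm //.
have : 0 <= (1 / 2) ^+ k :> R by rewrite exprn_ge0 //; lra.
rewrite /stage_scale; lra.
Qed.

(** The preimages of [y] under the successive flows form a sequence with steps [O((2/3)^k)]. The
    flow expands by at most [(9/8)^k], so it sends their limit to within [O((3/4)^k)] of [y]. *)
Lemma limit_surj y : exists x, g x = y.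
Proof.
have e0 := eta0; have e1 := eta1.
have /choice[u uP] : forall k, exists x, flow k x = y by move=> k; exact: flow_surj.
have e34 k : 0 < (3 / 4) ^+ k :> R by rewrite exprn_gt0 //; lra.
have hu k : enorm (u k.+1 - u k) <= eta / 20 * (2 / 3) ^+ k.
  rewrite -(ler_pM2l (e34 k)) mulrCA -exprMn.
  have -> : 3 / 4 * (2 / 3) = 1 / 2 :> R by field.
  apply: (@le_trans _ _ (enorm (flow k (u k.+1) - flow k (u k)))).
    apply: le_trans (flow_lower k _ _).
    rewrite ler_wpM2r //; apply: lerXn2r; rewrite ?nnegrE; lra.
  rewrite (uP k) -(uP k.+1) /= opprD addrA subrr add0r enormN.
  by apply: le_trans (v_small _ _) _; rewrite /stage_scale mulrA mulrAC.
have [|||l lP] := geometric_limit _ _ _ hu; try lra.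
exists l; apply/eqP; rewrite -subr_eq0; apply/eqP/enorm_eq0/eqP.
rewrite eq_le enorm_ge0 andbT.
pose c := n%:R * (eta / 20 / (1 - 2 / 3)).
apply: (@le_geometric_le0 _ _ (1 + c) (3 / 4)); try lra.
move=> k; rewrite mulrDl; have := enorm_triangle (g l) (flow k l) y.
have : enorm (g l - flow k l) <= 1 * (3 / 4) ^+ k.
  rewrite enormBC; apply: le_trans (close l k) _; rewrite /stage_scale mul1r.
  have : (1 / 2) ^+ k <= (3 / 4) ^+ k :> R by apply: lerXn2r; rewrite ?nnegrE; lra.
  have : 0 <= (1 / 2) ^+ k :> R by rewrite exprn_ge0 //; lra.
  lra.
have : enorm (flow k l - y) <= c * (3 / 4) ^+ k.
  rewrite -{1}(uP k); apply: le_trans (flow_upper k _ _) _.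
  rewrite enormBC.
  apply: (@le_trans _ _ ((9 / 8) ^+ k * (n%:R * (eta / 20 / (1 - 2 / 3) * (2 / 3) ^+ k)))).
    by apply: ler_pM => //; rewrite ?exprn_ge0 //; try lra; apply: lerXn2r; rewrite ?nnegrE; lra.
  rewrite !mulrA [_ ^+ k * n%:R]mulrC -!mulrA [_ ^+ k * (eta * _)]mulrC -!mulrA -exprMn /c.
  have -> : 2 / 3 * (9 / 8) = 3 / 4 :> R by field.
  by rewrite !mulrA.
lra.
Qed.

Lemma limit_bij : bijective g.
Proof.
have e0 := eta0; have e1 := eta1.
have /choice[f fP] := limit_surj.
by exists f => // x; apply: limit_inj; rewrite fP.
Qed.

End Limit.
End LimitOfPerturbations.

(** * Lipschitz extension *)

Section LipschitzExtension.
Variables (R : realType) (n : nat).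

(** The infimum of the cones [f a + L |x - a|]. The extra candidate [M] caps the extension and keeps
    the infimum meaningful when [A] is empty. *)
Lemma mcshane_real (A : set 'rV[R]_n) (f : 'rV[R]_n -> R) (L M : R) : 0 <= L -> 0 <= M ->
  (forall x y, A x -> A y -> `|f x - f y| <= L * enorm (x - y)) ->
  (forall x, A x -> `|f x| <= M) ->
  exists F : 'rV[R]_n -> R, [/\ forall x, A x -> F x = f x,
    forall x y, `|F x - F y| <= L * enorm (x - y) & forall x, `|F x| <= M].
Proof.
move=> L0 M0 fL fM.
pose S x := [set M] `|` [set f a + L * enorm (x - a) | a in A].
have SM x s : S x s -> - M <= s.
  move=> [->|[a /fM]]; first by lra.
  rewrite ler_norml => /andP[h _] <-; apply: le_trans h _.
  by rewrite lerDl mulr_ge0.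
have S0 x : S x !=set0 by exists M; left.
have Slb x : has_lbound (S x) by exists (- M) => s; exact: SM.
have lip x y : inf (S x) - L * enorm (x - y) <= inf (S y).
  apply: lb_le_inf => // s [->|[a Aa <-]].
    have : inf (S x) <= M by apply: ge_inf => //; left.
    have : 0 <= L * enorm (x - y) by rewrite mulr_ge0.
    lra.
  have : inf (S x) <= f a + L * enorm (x - a) by apply: ge_inf => //; right; exists a.
  have : L * enorm (x - a) <= L * (enorm (x - y) + enorm (y - a)).
    by rewrite ler_wpM2l // enorm_triangle.
  lra.
exists (fun x => inf (S x)); split => [x Ax|x y|x].
- apply/eqP; rewrite eq_le; apply/andP; split.
    apply: ge_inf => //; right; exists x => //.
    by rewrite subrr enorm0 mulr0 addr0.
  apply: lb_le_inf => // s [->|[a Aa <-]].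
    by have := fM x Ax; rewrite ler_norml => /andP[].
  by have := fL x a Ax Aa; rewrite ler_norml => /andP[_]; lra.
- have h1 := lip x y; have h2 := lip y x; rewrite (enormBC y) in h2.
  by rewrite ler_norml; apply/andP; split; lra.
- rewrite ler_norml; apply/andP; split; last by apply: ge_inf => //; left.
  by apply: lb_le_inf => // s; exact: SM.
Qed.

Lemma mcshane (A : set 'rV[R]_n) (w : 'rV[R]_n -> 'rV[R]_n) (L M : R) : 0 <= L -> 0 <= M ->
  (forall x y, A x -> A y -> enorm (w x - w y) <= L * enorm (x - y)) ->
  (forall x, A x -> enorm (w x) <= M) ->
  exists v, [/\ forall x, A x -> v x = w x,
    lipschitz_by (n%:R * L) v & forall x, enorm (v x) <= n%:R * M].
Proof.
move=> L0 M0 wL wM.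
have /choice[F FP] : forall i, exists F : 'rV[R]_n -> R, [/\ forall x, A x -> F x = w x ord0 i,
    forall x y, `|F x - F y| <= L * enorm (x - y) & forall x, `|F x| <= M].
  move=> i; apply: mcshane_real => // [x y Ax Ay|x Ax].
    by apply: le_trans (wL x y Ax Ay); have := le_coord_enorm (w x - w y) i; rewrite !mxE.
  by apply: le_trans (wM x Ax); exact: le_coord_enorm.
exists (fun x => \row_i F i x); split => [x Ax|x y|x].
- by apply/rowP => i; rewrite mxE; have [-> //] := FP i.
- rewrite -mulrA; apply: enorm_le_coord => i; rewrite !mxE.
  by have [_ h _] := FP i; exact: h.
- apply: enorm_le_coord => i; rewrite mxE.
  by have [_ _ h] := FP i; exact: h.
Qed.

End LipschitzExtension.

(** * Comparing and averaging the approximating planes *)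

Section Neighborhoods.
Variables (R : realType) (n : nat) (U : set 'rV[R]_n).

(** The condition [dist x U < rho] with a witness in place of the infimum, so that the triangle
    inequality applies directly. *)
Definition nbd (rho : R) (x : 'rV[R]_n) := exists2 u, U u & enorm (x - u) < rho.

Lemma nbd_shift (rho delta rho' : R) (x y : 'rV[R]_n) : nbd rho x -> enorm (y - x) <= delta ->
  rho + delta <= rho' -> nbd rho' y.
Proof.
move=> [u Uu xu] yx h; exists u => //.
by have := enorm_triangle y x u; lra.
Qed.

Lemma nbd_le (rho rho' : R) (x : 'rV[R]_n) : nbd rho x -> rho <= rho' -> nbd rho' x.
Proof. by move=> [u Uu xu] h; exists u => //; lra. Qed.

End Neighborhoods.

Section Averages.
Variables (R : realType) (n : nat) (I : finType).
Implicit Types (t : I -> R) (F : I -> 'rV[R]_n).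

Lemma average_dist t F w (b : R) : (forall c, 0 <= t c) -> \sum_c t c = 1 ->
  (forall c, enorm (F c - w) <= b) -> enorm (\sum_c t c *: F c - w) <= b.
Proof.
move=> t0 t1 h.
have -> : \sum_c t c *: F c - w = \sum_c t c *: (F c - w).
  under [RHS]eq_bigr do rewrite scalerBr.
  by rewrite sumrB -scaler_suml t1 scale1r.
apply: le_trans (ler_enorm_sum _) _; rewrite -[leRHS]mul1r -t1 mulr_suml.
by apply: ler_sum => c _; rewrite enormZ ger0_norm // ler_wpM2l.
Qed.

End Averages.

Section Flatness.
Variables (R : realType) (n : nat) (E U : set 'rV[R]_n) (eps : R).
Variable p : 'rV[R]_n -> R -> oproj R n.

(** The flatness hypothesis in terms of projections. The factor 2 is there because the distance to
    [E] need not be attained. *)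
Definition flat_at_scales := forall (z : 'rV[R]_n) (r : R), E z -> nbd U 2 z -> 0 < r -> r <= 1 ->
  (forall y, E y -> enorm (y - z) < 110 * r ->
     enorm ((y - z) - p z r (y - z)) <= eps * r) /\
  (forall u, enorm (p z r u) < 110 * r ->
     exists2 e, E e & enorm (z + p z r u - e) <= 2 * (eps * r)).

Hypotheses (flat : flat_at_scales) (eps_ge0 : 0 <= eps) (eps_le : eps <= 1 / 100).

(** For [u] of length [t = min(r, r')] in the first direction, [z + u] is within [2 eps r] of some
    [e] in [E], and both [e] and [z] are within [eps r'] of the second plane: in all
    [2 eps (r + r') <= 6 eps t]. *)
Lemma plane_gap (z z' : 'rV[R]_n) (r r' : R) : E z -> E z' -> nbd U 2 z -> nbd U 2 z' ->
  0 < r -> r <= 1 -> 0 < r' -> r' <= 1 -> r <= 2 * r' -> r' <= 2 * r ->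
  enorm (z - z') <= 20 * r -> oproj_le (6 * eps) (p z r) (p z' r').
Proof.
have e0 := eps_ge0; have e1 := eps_le.
move=> Ez Ez' Uz Uz' r0 r1 r0' r1' rr' r'r zz'.
set t := Num.min r r'.
have t0 : 0 < t by rewrite lt_min r0.
have tr : t <= r by rewrite ge_min lexx.
have tr' : t <= r' by rewrite ge_min lexx orbT.
have rrt : r + r' <= 3 * t by rewrite /t; case: (leP r r') => _; lra.
have rt : r <= 2 * t by rewrite /t; case: (leP r r') => _; lra.
have rt' : r' <= 2 * t by rewrite /t; case: (leP r r') => _; lra.
apply: (oproj_le_scale t0) => u pu ut.
have [_ h2] := flat Ez Uz r0 r1; have [h1 _] := flat Ez' Uz' r0' r1'.
have er : eps * r <= r by rewrite ler_piMl; lra.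
have [|e Ee ze] := h2 u; first by rewrite pu; lra.
rewrite pu in ze.
have ez' : enorm (e - z') < 110 * r'.
  have -> : e - z' = - (z + u - e) + u + (z - z') by vec.
  have := ler_enormD (- (z + u - e) + u) (z - z').
  have := ler_enormD (- (z + u - e)) u; rewrite enormN; lra.
have g1 := h1 e Ee ez'.
have g2 : enorm (z - z' - p z' r' (z - z')) <= eps * r' by apply: h1 => //; lra.
have g3 := oproj_res_contract (p z' r') (z + u - e).
have -> : u - p z' r' u = (z + u - e - p z' r' (z + u - e)) +
    (e - z' - p z' r' (e - z')) - (z - z' - p z' r' (z - z')).
  by rewrite !(linearB, linearD); vec.
apply: le_trans (ler_enormB _ _) _.
have := ler_enormD (z + u - e - p z' r' (z + u - e)) (e - z' - p z' r' (e - z')).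
have : eps * (r + r') <= eps * (3 * t) by rewrite ler_wpM2l.
lra.
Qed.

Lemma plane_dist (z z' : 'rV[R]_n) (r r' : R) : E z -> E z' -> nbd U 2 z -> nbd U 2 z' ->
  0 < r -> r <= 1 -> 0 < r' -> r' <= 1 -> r <= 2 * r' -> r' <= 2 * r ->
  enorm (z - z') <= 10 * r ->
  forall u, enorm (p z r u - p z' r' u) <= 12 * eps * enorm u.
Proof.
have e0 := eps_ge0.
move=> Ez Ez' Uz Uz' r0 r1 r0' r1' rr' r'r zz' u.
rewrite (_ : 12 * eps = 6 * eps + 6 * eps); last by ring.
apply: oproj_dist; rewrite ?mulr_ge0 //; apply: plane_gap => //; try lra.
by rewrite enormBC; lra.
Qed.

Definition foot (r : R) (z y : 'rV[R]_n) := z + p z r (y - z).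

Section Regularization.
Variable r : R.
Hypotheses (r_gt0 : 0 < r) (r_le1 : r <= 1).

Section TwoPlanes.
Variables z z0 : 'rV[R]_n.
Hypotheses (Ez : E z) (Ez0 : E z0) (Uz : nbd U 2 z) (Uz0 : nbd U 2 z0).
Hypothesis zz0 : enorm (z - z0) <= 10 * r.

Lemma foot_dist_lip (y y' : 'rV[R]_n) :
  enorm ((foot r z y - foot r z0 y) - (foot r z y' - foot r z0 y')) <=
    12 * eps * enorm (y - y').
Proof.
have r0 := r_gt0.
apply: le_trans (plane_dist Ez Ez0 Uz Uz0 r_gt0 r_le1 r_gt0 r_le1 _ _ zz0 (y - y')); try lra.
have e w : p z r (y - w) = p z r (y - y') + p z r (y' - w).
  by rewrite -linearD; congr (p z r _); vec.
have e' w : p z0 r (y - w) = p z0 r (y - y') + p z0 r (y' - w).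
  by rewrite -linearD; congr (p z0 r _); vec.
rewrite /foot e e' le_eqVlt.
by apply/orP; left; apply/eqP; congr enorm; vec.
Qed.

Lemma foot_dist (y : 'rV[R]_n) :
  enorm (foot r z y - foot r z0 y) <= 12 * eps * enorm (y - z) + eps * r.
Proof.
have r0 := r_gt0; have d0 := zz0.
have h1 : enorm (p z r (y - z) - p z0 r (y - z)) <= 12 * eps * enorm (y - z).
  by apply: plane_dist => //; lra.
have [h _] := flat Ez0 Uz0 r_gt0 r_le1.
have {}h : enorm (z - z0 - p z0 r (z - z0)) <= eps * r by apply: h => //; lra.
have -> : foot r z y - foot r z0 y = (p z r (y - z) - p z0 r (y - z)) + (z - z0 - p z0 r (z - z0)).
  have -> : p z0 r (y - z) = p z0 r (y - z0) - p z0 r (z - z0).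
    by rewrite -linearB; congr (p z0 r _); vec.
  by rewrite /foot; vec.
by apply: le_trans (ler_enormD _ _) _; lra.
Qed.

End TwoPlanes.

Variables (I : finType) (L : R) (theta : I -> 'rV[R]_n -> R) (ctr : I -> 'rV[R]_n -> 'rV[R]_n).
Hypotheses (L_ge0 : 0 <= L) (theta_ge0 : forall c y, 0 <= theta c y).
Hypothesis (theta1 : forall y, \sum_c theta c y = 1).
Hypothesis (ctr_close : forall c y, enorm (ctr c y - y) <= r / 2).
Hypothesis theta_lip : forall c y y',
  ctr c y = ctr c y' /\ `|theta c y - theta c y'| <= L / r * enorm (y - y') \/
  theta c y <= L / r * enorm (y - y') /\ theta c y' <= L / r * enorm (y - y').
Variable Z : 'rV[R]_n -> 'rV[R]_n.
Hypothesis ZP : forall q, (exists2 z, E z & enorm (z - q) <= r) ->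
  E (Z q) /\ enorm (Z q - q) <= r.

(** The plane used with colour [c] depends on the cell of [y] only: it is constant there and jumps
    only where [theta c] vanishes. *)
Definition regularization (y : 'rV[R]_n) := \sum_c theta c y *: foot r (Z (ctr c y)) y.

(** The radius [r / 2], added to the distance from [y] to the centres, guarantees a point of [E]
    within [r] of every centre; the chosen points are then within [3/2 r] of [y], hence within 2 of
    [U]. *)
Definition regular_point (y : 'rV[R]_n) :=
  nbd U (2 - 3 / 2 * r) y /\ exists2 z, E z & enorm (z - y) <= r / 2.

Lemma chosen_point (y : 'rV[R]_n) c : regular_point y ->
  [/\ E (Z (ctr c y)), enorm (Z (ctr c y) - y) <= 3 / 2 * r & nbd U 2 (Z (ctr c y))].
Proof.
have r0 := r_gt0; move=> [Uy [z Ez zy]].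
have [|EZ ZQ] := ZP (q := ctr c y).
  exists z => //; have := enorm_triangle z y (ctr c y); rewrite (enormBC y).
  by have := ctr_close c y; lra.
have Zy : enorm (Z (ctr c y) - y) <= 3 / 2 * r.
  by have := enorm_triangle (Z (ctr c y)) (ctr c y) y; have := ctr_close c y; lra.
by split => //; apply: nbd_shift Uy Zy _; lra.
Qed.

Lemma regularization_dist (y z0 : 'rV[R]_n) : regular_point y ->
  E z0 -> nbd U 2 z0 -> enorm (z0 - y) <= 2 * r ->
  enorm (regularization y - foot r z0 y) <= 19 * (eps * r).
Proof.
have r0 := r_gt0; have e0 := eps_ge0.
move=> Ry Ez0 Uz0 zy; apply: average_dist => // c.
have [EZ Zy UZ] := chosen_point c Ry.
have Zz : enorm (Z (ctr c y) - z0) <= 10 * r.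
  by have := enorm_triangle (Z (ctr c y)) y z0; rewrite (enormBC y); lra.
apply: le_trans (foot_dist EZ Ez0 UZ Uz0 Zz y) _; rewrite enormBC.
(* The constant 19 is [12 * 3/2 + 1]. *)
have : 12 * eps * enorm (Z (ctr c y) - y) <= 12 * eps * (3 / 2 * r).
  by rewrite ler_wpM2l // mulr_ge0.
lra.
Qed.

(* The estimate does not involve any previous approximation: this is what keeps the slopes of the
   successive surfaces from accumulating. *)
Lemma regularization_flat (y y' z0 : 'rV[R]_n) : regular_point y -> regular_point y' ->
  enorm (y - y') <= r -> E z0 -> nbd U 2 z0 -> enorm (z0 - y) <= 2 * r ->
  enorm (regularization y - regularization y' - p z0 r (y - y')) <=
    #|I|%:R * (12 + 38 * L) * eps * enorm (y - y').
Proof.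
have r0 := r_gt0; have e0 := eps_ge0; have L0 := L_ge0.
move=> Ry Ry' yy' Ez0 Uz0 zy; set d := enorm (y - y').
pose err c x := foot r (Z (ctr c x)) x - foot r z0 x.
have small x c : regular_point x -> enorm (z0 - x) <= 3 * r -> enorm (err c x) <= 19 * (eps * r).
  move=> Rx zx; have [EZ Zx UZ] := chosen_point c Rx.
  have Zz : enorm (Z (ctr c x) - z0) <= 10 * r.
    by have := enorm_triangle (Z (ctr c x)) x z0; rewrite (enormBC x); lra.
  apply: le_trans (foot_dist EZ Ez0 UZ Uz0 Zz x) _; rewrite enormBC.
  have : 12 * eps * enorm (Z (ctr c x) - x) <= 12 * eps * (3 / 2 * r).
    by rewrite ler_wpM2l // mulr_ge0.
  lra.
have zy' : enorm (z0 - y') <= 3 * r by have := enorm_triangle z0 y y'; lra.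
(* The foot on the fixed plane at [z0] is affine and the weights sum to one, so it can be subtracted
   in each term. *)
have -> : regularization y - regularization y' - p z0 r (y - y') =
    \sum_c (theta c y *: err c y - theta c y' *: err c y').
  rewrite sumrB /err; under eq_bigr do rewrite scalerBr.
  under [X in _ = _ - X]eq_bigr do rewrite scalerBr.
  rewrite !sumrB -!scaler_suml !theta1 !scale1r /regularization.
  have -> : p z0 r (y - y') = p z0 r (y - z0) - p z0 r (y' - z0).
    by rewrite -linearB; congr (p z0 r _); vec.
  by rewrite /foot; vec.
apply: le_trans (ler_enorm_sum _) _.
apply: (@le_trans _ _ (\sum_(c : I) ((12 + 38 * L) * eps * d))); last first.
  by rewrite sumr_const -[leLHS]mulr_natl -!mulrA.
apply: ler_sum => c _.
have sy := small y c Ry; have sy' := small y' c Ry' zy'.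
have {sy} sy : enorm (err c y) <= 19 * (eps * r) by apply: sy; lra.
have LE : L / r * d * (19 * (eps * r)) = 19 * L * eps * d by field; rewrite gt_eqF.
have d0 : 0 <= d by exact: enorm_ge0.
have Led : 0 <= L * eps * d by rewrite !mulr_ge0.
have ed : 0 <= eps * d by rewrite mulr_ge0.
have er : 0 <= 19 * (eps * r) by rewrite !mulr_ge0 // ltW.
(* In a common cell the plane is the same at both points and the product rule applies; otherwise
   both weights are [O(d / r)], which compensates the jump of the plane. *)
have [[cc tt]|[t1 t2]] := theta_lip c y y'.
  have -> : theta c y *: err c y - theta c y' *: err c y' =
      theta c y *: (err c y - err c y') + (theta c y - theta c y') *: err c y' by vec.
  apply: le_trans (ler_enormD _ _) _; rewrite !enormZ.
  have h1 : `|theta c y - theta c y'| * enorm (err c y') <= L / r * d * (19 * (eps * r)).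
    by apply: ler_pM.
  have h2 : `|theta c y| * enorm (err c y - err c y') <= 1 * (12 * eps * d).
    apply: ler_pM => //.
      rewrite ger0_norm // -(theta1 y) (bigD1 c) //= lerDl.
      by apply: sumr_ge0 => i _; exact: theta_ge0.
    rewrite /err -cc; have [EZ Zy UZ] := chosen_point c Ry.
    apply: foot_dist_lip => //.
    by have := enorm_triangle (Z (ctr c y)) y z0; rewrite (enormBC y); lra.
  lra.
apply: le_trans (ler_enormB _ _) _; rewrite !enormZ !ger0_norm //.
have h1 : theta c y * enorm (err c y) <= L / r * d * (19 * (eps * r)) by apply: ler_pM.
have h2 : theta c y' * enorm (err c y') <= L / r * d * (19 * (eps * r)) by apply: ler_pM.
lra.
Qed.

End Regularization.
End Flatness.

(** * The inductive step *)

Section Stages.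
Variables (R : realType) (n : nat) (E U : set 'rV[R]_n) (eps : R).
Variable p : 'rV[R]_n -> R -> oproj R n.

(* The surface [S] near [U], seen at scale [r]: close to [E], of small slope at all scales [<= r],
   without holes ([stage_full]) and not missing any part of [E]. *)
Record stage (b r : R) (S : set 'rV[R]_n) : Prop := Stage {
  stage_near : forall x, S x -> nbd U (10 * r) x -> exists2 z, E z & enorm (x - z) <= b * r;
  stage_flat : forall x x' z, S x -> S x' -> nbd U (10 * r) x -> nbd U (10 * r) x' ->
    enorm (x - x') <= r -> E z -> enorm (z - x) <= r ->
    enorm ((x - x') - p z r (x - x')) <= b * enorm (x - x');
  stage_full : forall x z u, S x -> nbd U (10 * r) x -> E z -> enorm (z - x) <= r ->
    enorm (p z r u) <= r / 10 ->
    exists2 x', S x' & enorm (x' - x - p z r u) <= enorm (p z r u) / 2;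
  stage_cover : forall z, E z -> nbd U (10 * r) z -> exists2 x, S x & enorm (x - z) <= r / 10 }.

(* Iterating [stage_full] from the points it produces makes the tangential error geometrically
   small, and [stage_flat] controls the normal one. *)
Lemma stage_full_sharp (b r : R) (S : set 'rV[R]_n) (y z u : 'rV[R]_n) :
  stage b r S -> 0 < eps -> 0 < r -> eps <= b -> b <= 1 / 400 ->
  S y -> nbd U (8 * r) y -> E z -> enorm (z - y) <= b * r -> enorm (p z r u) <= r / 10 ->
  exists2 y', S y' & enorm (y' - y - p z r u) <= 4 * b * enorm (p z r u).
Proof.
move=> st e0 r0 eb b1 Sy Uy Ez zy; set w := p z r u => wr.
have w0 : 0 <= enorm w by exact: enorm_ge0.
have br : b * r <= 1 / 400 * r by rewrite ler_wpM2r // ltW.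
(* A step covers at most 3/2 of the remaining tangential vector and halves it, so the total
   displacement stays below [3 |w|]. *)
have iter J : exists y', [/\ S y', enorm (y' - y) <= 3 * (1 - (1 / 2) ^+ J) * enorm w &
    enorm (w - p z r (y' - y)) <= (1 / 2) ^+ J * enorm w].
  elim: J => [|J [x [Sx xy wx]]].
    exists y; rewrite subrr linear0 subr0 enorm0 expr0 mul1r lexx subrr mulr0 mul0r.
    by split.
  have q0 : 0 <= (1 / 2) ^+ J :> R by rewrite exprn_ge0 //; lra.
  have q1 : (1 / 2) ^+ J <= 1 :> R by apply: exprn_ile1; lra.
  have qw0 : 0 <= (1 / 2) ^+ J * enorm w by rewrite mulr_ge0.
  have qw1 : (1 / 2) ^+ J * enorm w <= enorm w by rewrite ler_piMl.
  have xy' : enorm (x - y) <= 3 / 10 * r by lra.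
  have pE : p z r (u - (x - y)) = w - p z r (x - y) by rewrite linearB.
  have [|||||x' Sx' x'P] := stage_full st (x := x) (z := z) (u := u - (x - y)) => //.
  - by apply: nbd_shift Uy xy' _; lra.
  - by have := enorm_triangle z y x; rewrite (enormBC y); lra.
  - by rewrite pE; lra.
  rewrite pE in x'P; exists x'; rewrite exprS; split => //.
    have -> : x' - y = (x' - x - (w - p z r (x - y))) + (w - p z r (x - y)) + (x - y) by vec.
    have := ler_enormD (x' - x - (w - p z r (x - y))) (w - p z r (x - y)).
    have := ler_enormD (x' - x - (w - p z r (x - y)) + (w - p z r (x - y))) (x - y).
    lra.
  have -> : w - p z r (x' - y) = - p z r (x' - x - (w - p z r (x - y))).
    rewrite /w !linearB /= !oprojK; vec.
  rewrite enormN; apply: le_trans (oproj_contract _ _) _; lra.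
(* Finitely many steps are enough, so no limit point of [S] is taken. The final constant is [3 b]
   from the slope plus [2^-J <= b]. *)
have [J Je] : exists J, (1 / 2) ^+ J <= eps.
  apply: contrapT => /forallNP nk; have : eps <= 0; last by lra.
  apply: (@le_geometric_le0 _ eps 1 (1 / 2)); try lra.
  by move=> k; have := nk k => /negP; rewrite -ltNge [leRHS]mul1r => /ltW.
have [y' [Sy' yy' wy']] := iter J.
have q0 : 0 <= (1 / 2) ^+ J :> R by rewrite exprn_ge0 //; lra.
have qw0 : 0 <= (1 / 2) ^+ J * enorm w by rewrite mulr_ge0.
have {}yy' : enorm (y' - y) <= 3 * enorm w by lra.
exists y' => //.
have h1 : enorm (y' - y - p z r (y' - y)) <= b * enorm (y' - y).
  apply: (stage_flat st) => //; try lra.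
  - have yr : enorm (y' - y) <= 3 / 10 * r by lra.
    by apply: nbd_shift Uy yr _; lra.
  - by apply: nbd_le Uy _; lra.
  - by have := enorm_triangle z y y'; rewrite (enormBC y); lra.
have -> : y' - y - w = (y' - y - p z r (y' - y)) - (w - p z r (y' - y)) by vec.
apply: le_trans (ler_enormB _ _) _.
have : b * enorm (y' - y) <= b * (3 * enorm w) by rewrite ler_wpM2l //; lra.
have : (1 / 2) ^+ J * enorm w <= b * enorm w by rewrite ler_wpM2r //; lra.
lra.
Qed.

End Stages.

(** * One step: the displacement *)

Section Step.
Variables (R : realType) (n : nat) (E U : set 'rV[R]_n) (eps : R).
Variable p : 'rV[R]_n -> R -> oproj R n.

(** On the surface near [U], [y] and [h y] are both close to one plane, so [h y - y] has size at
    most [2 b r]; both surfaces have slope at most [b] over that plane, so the difference has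
    Lipschitz constant [2 b] at distances up to [r]. Larger distances give [4 b], and the extension
    gives the factor [n]. *)
Lemma stage_displacement (I : finType) (L b r : R) (theta : I -> 'rV[R]_n -> R)
    (ctr : I -> 'rV[R]_n -> 'rV[R]_n) (S : set 'rV[R]_n) :
  (0 < n)%N -> flat_at_scales E U eps p -> 0 < eps ->
  42 * eps <= b -> #|I|%:R * (12 + 38 * L) * eps <= b -> b <= 1 / 400 ->
  0 < r -> r <= 1 / 20 -> 0 <= L ->
  (forall c y, 0 <= theta c y) -> (forall y, \sum_c theta c y = 1) ->
  (forall c y, enorm (ctr c y - y) <= r / 2) ->
  (forall c y y',
    ctr c y = ctr c y' /\ `|theta c y - theta c y'| <= L / r * enorm (y - y') \/
    theta c y <= L / r * enorm (y - y') /\ theta c y' <= L / r * enorm (y - y')) ->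
  stage E U p b r S ->
  exists v h : 'rV[R]_n -> 'rV[R]_n, 
    [/\ forall x, enorm (v x) <= 4 * n%:R * b * r,
        lipschitz_by (4 * n%:R * b) v,
        forall x, ~ nbd U (10 * r) x -> v x = 0,
        forall y, S y -> nbd U (9 * r) y -> y + v y = h y &
     (forall y z0, S y -> nbd U (9 * r) y -> E z0 -> enorm (z0 - y) <= 2 * r ->
          enorm (h y - foot p r z0 y) <= 19 * (eps * r)) /\
     (forall y y' z0, S y -> S y' -> nbd U (9 * r) y -> nbd U (9 * r) y' ->
          enorm (y - y') <= r -> E z0 -> enorm (z0 - y) <= 2 * r ->
          enorm (h y - h y' - p z0 r (y - y')) <=
            #|I|%:R * (12 + 38 * L) * eps * enorm (y - y'))].
Proof.
move=> n0 flat e0 eb Kb b1 r0 r1 L0 th0 th1 ctrc thl st.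
have /choice[Z ZP] : forall q : 'rV[R]_n, exists z, (exists2 z, E z & enorm (z - q) <= r) ->
    E z /\ enorm (z - q) <= r.
  move=> q; have [[z Ez zq]|nz] := EM (exists2 z, E z & enorm (z - q) <= r).
    by exists z.
  by exists q.
pose h := regularization p r theta ctr Z.
have b0 : 0 <= b by lra.
have r910 : 9 * r <= 10 * r by lra.
have {L0 Kb} LK := conj L0 Kb.
have er1 : eps <= 1 / 100 /\ r <= 1 by split; lra.
have br : b * r <= 1 / 400 * r by rewrite ler_wpM2r // ltW.
have br0 : 0 <= b * r by rewrite mulr_ge0 // ltW.
have ebr : 42 * (eps * r) <= b * r by rewrite mulrA ler_wpM2r // ltW.
have regular y : S y -> nbd U (9 * r) y -> regular_point E U r y.
  move=> Sy Uy; split; first by apply: nbd_le Uy _; lra.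
  have [|z Ez yz] := stage_near st Sy; first exact: nbd_le Uy r910.
  by exists z => //; rewrite enormBC; lra.
have hfoot y z0 : S y -> nbd U (9 * r) y -> E z0 -> enorm (z0 - y) <= 2 * r ->
    enorm (h y - foot p r z0 y) <= 19 * (eps * r).
  move=> Sy Uy Ez zy.
  apply: (regularization_dist flat (ltW e0) er1.1 r0 er1.2 th0 th1 ctrc ZP) => //.
    exact: regular.
  by apply: nbd_shift Uy zy _; lra.
have hflat y y' z0 : S y -> S y' -> nbd U (9 * r) y -> nbd U (9 * r) y' ->
    enorm (y - y') <= r -> E z0 -> enorm (z0 - y) <= 2 * r ->
    enorm (h y - h y' - p z0 r (y - y')) <= #|I|%:R * (12 + 38 * L) * eps * enorm (y - y').
  move=> Sy Sy' Uy Uy' yy' Ez zy.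
  apply: (regularization_flat flat (ltW e0) er1.1 r0 er1.2 LK.1 th0 th1 ctrc thl ZP) => //.
  - exact: regular.
  - exact: regular.
  - by apply: nbd_shift Uy zy _; lra.
pose inner y := S y /\ nbd U (9 * r) y.
(* Within [10 r] of [U], the points off [S] or outside the [9 r] neighbourhood are left to the
   extension; the two prescriptions are [r] apart. *)
pose A := inner `|` [set y | ~ nbd U (10 * r) y].
pose w y := if `[< inner y >] then h y - y else 0.
have win y : inner y -> w y = h y - y by move=> iy; rewrite /w asboolT.
have wout y : ~ nbd U (10 * r) y -> w y = 0.
  move=> oy; rewrite /w asboolF // => -[_ /nbd_le oy']; apply: oy; apply: oy'; lra.
have wM y : A y -> enorm (w y) <= 2 * b * r.
  move=> [iy|/wout ->]; last by rewrite enorm0 !mulr_ge0 // ltW.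
  rewrite win //; have [Sy Uy] := iy.
  have [|z Ez yz] := stage_near st Sy; first exact: nbd_le Uy r910.
  have zy : enorm (z - y) <= 2 * r by rewrite enormBC; lra.
  have := hfoot y z Sy Uy Ez zy; rewrite enormBC => h1.
  have -> : h y - y = - (foot p r z y - h y) - (y - z - p z r (y - z)).
    by rewrite /foot; vec.
  apply: le_trans (ler_enormB _ _) _; rewrite enormN.
  by have := oproj_res_contract (p z r) (y - z); lra.
have sep y y' : inner y -> ~ nbd U (10 * r) y' -> r <= enorm (y - y').
  move=> [_ Uy] Uy'; rewrite leNgt; apply/negP => yy'; apply: Uy'.
  by apply: nbd_shift Uy (_ : _ <= r) _; [rewrite enormBC ltW|lra].
have wL y y' : A y -> A y' -> enorm (w y - w y') <= 4 * b * enorm (y - y').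
  have d0 := enorm_ge0 (y - y').
  have far : r <= enorm (y - y') -> 4 * (b * r) <= 4 * b * enorm (y - y').
    by move=> ryy; rewrite mulrA ler_wpM2l // mulr_ge0.
  move=> Ay Ay'; have wy := wM y Ay; have wy' := wM y' Ay'.
  have ww := ler_enormB (w y) (w y').
  case: Ay Ay' => [iy|oy] [iy'|oy'].
  (* Beyond distance [r], the bound on the size of [w] suffices. *)
  - have [yy'|/ltW/far] := leP (enorm (y - y')) r; last by clear -wy wy' ww; lra.
    rewrite !win //; have [Sy Uy] := iy; have [Sy' Uy'] := iy'.
    have [|z Ez yz] := stage_near st Sy; first exact: nbd_le Uy r910.
    have zy : enorm (z - y) <= 2 * r by rewrite enormBC; clear -yz br r0; lra.
    have h1 := le_trans (hflat y y' z Sy Sy' Uy Uy' yy' Ez zy) (ler_wpM2r d0 LK.2).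
    have h2 : enorm (y - y' - p z r (y - y')) <= b * enorm (y - y').
      apply: (stage_flat st) => //.
      - exact: nbd_le Uy r910.
      - exact: nbd_le Uy' r910.
      - by rewrite enormBC; clear -yz br r0; lra.
    have -> : h y - y - (h y' - y') = (h y - h y' - p z r (y - y')) - (y - y' - p z r (y - y')).
      by vec.
    have := ler_enormB (h y - h y' - p z r (y - y')) (y - y' - p z r (y - y')).
    by have := mulr_ge0 b0 d0; clear -h1 h2; lra.
  - by have := far (sep _ _ iy oy'); lra.
  - by have := far; rewrite enormBC => /(_ (sep _ _ iy' oy)); rewrite (enormBC y'); lra.
  - by rewrite !wout // subrr enorm0 !mulr_ge0.
have [||v [vA vL vM]] := mcshane _ _ wL wM; rewrite ?mulr_ge0 ?(ltW r0) //.
have nb : 0 <= n%:R * b by rewrite mulr_ge0.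
exists v, h; split => //.
- move=> x; apply: le_trans (vM x) _.
  have : 0 <= n%:R * b * r by rewrite mulr_ge0 // ltW.
  lra.
- by move=> x y; rewrite (mulrC 4) -[n%:R * 4 * b]mulrA; exact: vL.
- by move=> x ox; rewrite vA; [exact: wout|right].
- by move=> y Sy Uy; rewrite vA ?win //; [vec|left].
Qed.

End Step.

(** * One step: the conditions at half the scale *)

Section NextStage.
Variables (R : realType) (n : nat) (E U : set 'rV[R]_n) (eps : R).
Variable p : 'rV[R]_n -> R -> oproj R n.

(** The foot of [y] is within [2 eps r] of [E] and within [19 eps r] of [h y]: in all [42 eps] times
    [r / 2]. For the slope, [2 k] comes from [|y - y'|] being at most twice the distance of the
    images, and [12 eps] from the change of plane. Fullness and covering are transported from
    [S]. *)
Lemma stage_next (b eta k r : R) (S : set 'rV[R]_n) (v h : 'rV[R]_n -> 'rV[R]_n) :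
  flat_at_scales E U eps p -> 0 < eps -> 42 * eps <= b -> 4 * b <= eta -> eta <= 1 / 100 ->
  2 * k + 12 * eps <= b -> 0 <= k ->
  0 < r -> r <= 1 / 20 ->
  stage E U p b r S ->
  (forall x, enorm (v x) <= eta * r) -> lipschitz_by eta v ->
  (forall y, S y -> nbd U (9 * r) y -> y + v y = h y) ->
  (forall y z0, S y -> nbd U (9 * r) y -> E z0 -> enorm (z0 - y) <= 2 * r ->
    enorm (h y - foot p r z0 y) <= 19 * (eps * r)) ->
  (forall y y' z0, S y -> S y' -> nbd U (9 * r) y -> nbd U (9 * r) y' ->
    enorm (y - y') <= r -> E z0 -> enorm (z0 - y) <= 2 * r ->
    enorm (h y - h y' - p z0 r (y - y')) <= k * enorm (y - y')) ->
  stage E U p b (r / 2) [set y + v y | y in S].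
Proof.
move=> flat e0 eb beta eta1 kb k0 r0 r1 st vs vl vh hfoot hflat.
have b0 : 0 <= b by lra.
have {kb k0} kk := conj kb k0.
have be : [/\ b <= 1 / 400, eps <= 1 / 100 & eps <= b] by split; lra.
have eta0 : 0 <= eta by lra.
have half : [/\ r <= 1, 0 < r / 2, r / 2 <= 1, r <= 2 * (r / 2) & r / 2 <= 2 * r].
  by split; lra.
have ebr : 42 * (eps * r) <= b * r by rewrite mulrA ler_wpM2r // ltW.
have br : 4 * (b * r) <= eta * r by rewrite mulrA ler_wpM2r // ltW.
have er : eta * r <= 1 / 100 * r by rewrite ler_wpM2r // ltW.
have br0 : 0 <= b * r by rewrite mulr_ge0 // ltW.
have eps0 := ltW e0.
have back y rho : nbd U rho (y + v y) -> nbd U (rho + r / 100) y.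
  move=> Uy; apply: (nbd_shift Uy (_ : _ <= r / 100)); last by [].
  by rewrite opprD addrA subrr add0r enormN; have := vs y; lra.
have inside y : nbd U (10 * (r / 2)) (y + v y) -> nbd U (8 * r) y.
  by move=> /back Uy; apply: nbd_le Uy _; lra.
have center y : S y -> nbd U (8 * r) y ->
    exists z, [/\ E z, enorm (z - y) <= b * r, nbd U 2 z & enorm (z - y) <= 2 * r].
  move=> Sy Uy; have [|z Ez yz] := stage_near st Sy; first by apply: nbd_le Uy _; lra.
  rewrite enormBC in yz; exists z; split => //; last by lra.
  by apply: nbd_shift Uy yz _; lra.
have n9 y : nbd U (8 * r) y -> nbd U (9 * r) y by move=> /nbd_le; apply; lra.
have meet (y z z' : 'rV[R]_n) : enorm (z - y) <= b * r -> enorm (z' - (y + v y)) <= r / 2 ->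
    enorm (z - z') <= 10 * r.
  move=> zy zx; have -> : z - z' = (z - y) - v y - (z' - (y + v y)) by vec.
  have := ler_enormB (z - y - v y) (z' - (y + v y)); have := ler_enormB (z - y) (v y).
  by have := vs y; clear -zy zx br er r0; lra.
split.
- move=> _ [y Sy <-] /inside Uy.
  have [z [Ez zy Uz zy2]] := center y Sy Uy.
  have hz := hfoot y z Sy (n9 y Uy) Ez zy2; rewrite vh //; last exact: n9.
  have [|_ /(_ (y - z))[|e Ee]] := flat z r Ez Uz r0; first by case: half.
    by have := oproj_contract (p z r) (y - z); rewrite enormBC in zy; clear -zy br er r0; lra.
  move=> ze; exists e => //.
  by have := enorm_triangle (h y) (foot p r z y) e; rewrite /foot in hz *; lra.
- move=> _ _ z' [y Sy <-] [y' Sy' <-] Uy0 Uy'0 xx Ez' zx.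
  have Uz' : nbd U 2 z' by apply: nbd_shift Uy0 zx _; lra.
  have Uy := inside y Uy0; have Uy' := inside y' Uy'0.
  have [z [Ez zy Uz zy2]] := center y Sy Uy.
  have low := perturbation_lower y y' vl.
  have d0 := enorm_ge0 (y - y').
  have ed : eta * enorm (y - y') <= 1 / 100 * enorm (y - y') by rewrite ler_wpM2r.
  have yy : enorm (y - y') <= r by clear -low ed xx d0 r0; lra.
  have zz := meet _ _ _ zy zx.
  set x := y + v y - (y' + v y').
  have hk : enorm (x - p z r x) <= k * enorm (y - y').
    apply: le_trans (hflat y y' z Sy Sy' (n9 y Uy) (n9 y' Uy') yy Ez zy2).
    rewrite /x !vh //; try exact: n9.
    by apply: oproj_best; rewrite oprojK.
  have hp : enorm (p z r x - p z' (r / 2) x) <= 12 * eps * enorm x.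
    have [_ e1 _] := be; have [rle1 half0 half1 half2 half3] := half.
    exact: (plane_dist flat eps0 e1 Ez Ez' Uz Uz' r0 rle1 half0 half1 half2 half3 zz).
  have -> : x - p z' (r / 2) x = (x - p z r x) + (p z r x - p z' (r / 2) x) by vec.
  apply: le_trans (ler_enormD _ _) _.
  have [kb k0] := kk; have dx : enorm (y - y') <= 2 * enorm x by clear -low ed d0; lra.
  have : k * enorm (y - y') <= k * (2 * enorm x) by rewrite ler_wpM2l.
  have : (2 * k + 12 * eps) * enorm x <= b * enorm x by rewrite ler_wpM2r // enorm_ge0.
  clear -hk hp; lra.
- move=> _ z' u [y Sy <-] Uy0 Ez' zx; set w := p z' (r / 2) u => wr.
  have Uz' : nbd U 2 z' by apply: nbd_shift Uy0 zx _; lra.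
  have Uy := inside y Uy0.
  have [z [Ez zy Uz zy2]] := center y Sy Uy.
  have zz := meet _ _ _ zy zx.
  have w0 : 0 <= enorm w by exact: enorm_ge0.
  have hw : enorm (p z r w - w) <= 12 * eps * enorm w.
    have {2}<- : p z' (r / 2) w = w by rewrite /w oprojK.
    have [_ e1 _] := be; have [rle1 half0 half1 half2 half3] := half.
    exact: (plane_dist flat eps0 e1 Ez Ez' Uz Uz' r0 rle1 half0 half1 half2 half3 zz).
  have cw := oproj_contract (p z r) w.
  have wr' : enorm (p z r w) <= r / 10 by clear -cw wr r0; lra.
  have [b1 _ eb1] := be.
  have [y' Sy' y'P] := stage_full_sharp st e0 r0 eb1 b1 Sy Uy Ez zy wr'.
  exists (y' + v y'); first by exists y'.
  have b4 : 0 <= 4 * b <= 1 / 100 by clear -b0 beta eta1; apply/andP; split; lra.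
  have h1 : 4 * b * enorm (p z r w) <= 1 / 100 * enorm w.
    by move/andP: b4 => [b40 b41]; apply: ler_pM.
  have h2 := vl y' y.
  have h3 : enorm (y' - y) <= 2 * enorm w.
    by have := lerB_enorm (y' - y) (p z r w); clear -y'P h1 cw w0; lra.
  have h4 : eta * enorm (y' - y) <= 1 / 100 * (2 * enorm w).
    exact: ler_pM.
  have h5 : 12 * eps * enorm w <= 1 / 100 * enorm w.
    by rewrite ler_wpM2r //; clear -eb beta eta1 eps0; lra.
  have -> : y' + v y' - (y + v y) - w = (y' - y - p z r w) + (v y' - v y) + (p z r w - w) by vec.
  have := ler_enormD (y' - y - p z r w) (v y' - v y).
  have := ler_enormD (y' - y - p z r w + (v y' - v y)) (p z r w - w).
  clear -y'P h1 h2 h4 h5 hw w0; lra.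
(* A point of [S] within [r / 10] of [z'] is moved along the plane by the projection of [z' - y];
   what remains is nearly normal to the plane, hence small compared with [r / 20]. *)
- move=> z' Ez' Uz'.
  have [|y Sy yz'] := stage_cover st Ez'; first by apply: nbd_le Uz' _; lra.
  have Uy : nbd U (8 * r) y by apply: nbd_shift Uz' yz' _; lra.
  have [z [Ez zy Uz zy2]] := center y Sy Uy.
  set w := p z r (z' - y).
  have wr : enorm w <= r / 10.
    by apply: le_trans (oproj_contract _ _) _; rewrite enormBC.
  have [b1 _ eb1] := be.
  have [y' Sy' y'P] := stage_full_sharp st e0 r0 eb1 b1 Sy Uy Ez zy wr.
  exists (y' + v y'); first by exists y'.
  have w0 : 0 <= enorm w by exact: enorm_ge0.
  have h1 : 4 * b * enorm w <= 1 / 100 * (r / 10).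
    by apply: ler_pM => //; clear -b0 beta eta1 wr; lra.
  have [|hz _] := flat z r Ez Uz r0; first by case: half.
  have {hz} hz : enorm (z' - z - p z r (z' - z)) <= eps * r.
    apply: hz => //; have := enorm_triangle z' y z.
    by rewrite (enormBC z' y) (enormBC y z); clear -yz' zy br er r0; lra.
  have h2 := oproj_res_le (p z r) (z' - y) (z' - z).
  rewrite (_ : z' - y - (z' - z) = z - y) in h2; last by vec.
  have -> : y' + v y' - z' = (y' - y - w) + v y' - (z' - y - w) by vec.
  have := ler_enormD (y' - y - w) (v y').
  have := ler_enormB (y' - y - w + v y') (z' - y - w).
  have := vs y'; rewrite -/w in y'P h2; clear -y'P h1 h2 hz zy ebr br er r0; lra.
Qed.

End NextStage.

(** * Flat model surfaces *)

Section Distances.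
Variables (R : realType) (n : nat).
Implicit Types (x y z : 'rV[R]_n) (A U : set 'rV[R]_n).

Lemma dist_lt A x (r r' : R) : (dist x A <= r%:E)%E -> r < r' ->
  exists2 a, A a & enorm (x - a) < r'.
Proof.
move=> h rr'; have : (dist x A < r'%:E)%E by apply: le_lt_trans h _; rewrite lte_fin.
by move=> /ereal_inf_lt[_ [a Aa <-]]; rewrite lte_fin => xa; exists a.
Qed.

Lemma nbd_dist U x (rho : R) : nbd U rho x -> (dist x U <= rho%:E)%E.
Proof.
move=> [u Uu xu]; apply: (@le_trans _ _ (enorm (x - u))%:E); last by rewrite lee_fin ltW.
by apply: ereal_inf_lbound; exists u.
Qed.

Lemma dist_plane_res (V : {vspace 'rV[R]_n}) (q : oproj R n) x z (c : R) : oproj_on q V ->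
  (dist x (plane z V) <= c%:E)%E -> enorm ((x - z) - q (x - z)) <= c.
Proof.
move=> qV h; apply/ler_addgt0Pr => e e0.
have [|a Va xa] := dist_lt h (r' := c + e); first by rewrite ltrDl.
apply: le_trans (ltW xa); rewrite (_ : x - a = x - z - (a - z)); last by vec.
by apply: oproj_best; apply: qV.2.
Qed.

End Distances.

Section FlatGraphs.
Variables (R : realType) (n : nat).
Implicit Types (V : {vspace 'rV[R]_n}) (F : 'rV[R]_n -> 'rV[R]_n) (x y v w : 'rV[R]_n).

Lemma is_derive_along F y v w (s : R) : derivable F (y + s *: v) v ->
  is_derive s 1 (fun t : R => dot (F (y + t *: v)) w) (dot ('D_v F (y + s *: v)) w).
Proof.
move=> dF.
have coordE i : is_derive s (1 : R) (fun t : R => F (y + t *: v) ord0 i)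
    ('D_v F (y + s *: v) ord0 i).
  have di := (derivable_mxP _ _ _).1 dF ord0 i.
  have quot : (fun h : R => h^-1 *: (((fun t : R => F (y + t *: v) ord0 i) \o
        shift s) (h *: (1 : R)) - F (y + s *: v) ord0 i)) =
      (fun h : R => h^-1 *: (((fun z => F z ord0 i) \o
        shift (y + s *: v)) (h *: v) - F (y + s *: v) ord0 i)).
    apply/funext => h /=; congr (_ *: (F _ _ _ - _)).
    by rewrite addrCA -scalerDl /GRing.scale /= mulr1.
  split; first by rewrite /derivable quot.
  by rewrite derive_mx // mxE /derive quot.
have -> : (fun t : R => dot (F (y + t *: v)) w) =
    \sum_(i < n) (w ord0 i \*: (fun t : R => F (y + t *: v) ord0 i)).
  apply/funext => t; rewrite fct_sumE; apply: eq_bigr => i _.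
  by rewrite mulrC.
have -> : dot ('D_v F (y + s *: v)) w = \sum_(i < n) w ord0 i *: 'D_v F (y + s *: v) ord0 i.
  by apply: eq_bigr => i _; rewrite mulrC.
by apply: is_derive_sum => i; exact: is_deriveZ.
Qed.

(** The mean value theorem for the scalar product of [F] with [w = F y - F y'] along the segment
    gives [|w|^2 <= eps |y - y'| |w|]. *)
Lemma plane_lipschitz V F x (eps : R) :
  (forall y, plane x V y -> forall v, v \in V -> derivable F y v) ->
  (forall y, plane x V y -> forall v, v \in V -> enorm v <= 1 -> enorm ('D_v F y) <= eps) ->
  forall y y', plane x V y -> plane x V y' -> enorm (F y - F y') <= eps * enorm (y - y').
Proof.
move=> dF bF y y' Vy Vy'; set t := enorm (y - y').
have [t0|tn0] := eqVneq t 0.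
  have -> : y = y' by apply/eqP; rewrite -subr_eq0; apply/eqP/enorm_eq0.
  by rewrite subrr enorm0 t0 mulr0.
have t0 : 0 < t by rewrite lt_neqAle eq_sym tn0 enorm_ge0.
pose v := t^-1 *: (y - y'); pose w := F y - F y'.
have vV : v \in V.
  apply: memvZ; rewrite (_ : y - y' = y - x - (y' - x)); last by vec.
  exact: memvB.
have v1 : enorm v = 1 by rewrite enormZ ger0_norm ?invr_ge0 ?(ltW t0) // mulVf.
have line s : plane x V (y' + s *: v).
  rewrite /plane /= (_ : y' + s *: v - x = (y' - x) + s *: v); last by vec.
  by apply: memvD => //; exact: memvZ.
pose phi (s : R) := dot (F (y' + s *: v)) w.
have dphi (s : R) : is_derive s 1 phi (dot ('D_v F (y' + s *: v)) w).
  by apply: is_derive_along; exact: dF.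
have [|c _] := @MVT R phi (fun s => dot ('D_v F (y' + s *: v)) w) 0 t t0.
  by apply: derivable_within_continuous => s _; have [] := dphi s.
rewrite subr0 /phi scale0r addr0.
have -> : y' + t *: v = y by rewrite /v scalerA divff // scale1r; vec.
rewrite -dotBl -/w -enorm_sqr => wE.
have [->|wn0] := eqVneq (enorm w) 0.
  apply: mulr_ge0; last exact: ltW.
  by apply: le_trans (bF _ (line 0) v vV _); rewrite ?v1 ?enorm_ge0.
have w0 : 0 < enorm w by rewrite lt_neqAle eq_sym wn0 enorm_ge0.
rewrite -(ler_pM2r w0) -expr2 wE mulrAC ler_pM2r //.
apply: le_trans (dot_le_enorm _ _) _; rewrite ler_pM2r //.
by apply: bF; rewrite ?v1.
Qed.

End FlatGraphs.

Section FlatModel.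
Variables (R : realType) (n d : nat).
Implicit Types (S : set 'rV[R]_n) (x y u : 'rV[R]_n).

(** What the construction uses of the model: small slope, no holes over the plane, and closedness
    near each of its points. *)
Lemma flat_model_local (eps : R) S x : flat_model_surface d eps S -> 0 <= eps -> eps <= 1 -> S x ->
  exists (V : {vspace 'rV[R]_n}) (q : oproj R n),
  [/\ \dim V = d, oproj_on q V,
    forall y y', S y -> S y' -> enorm (y - x) < 200 -> enorm (y' - x) < 200 ->
      enorm ((y - y') - q (y - y')) <= eps * enorm (y - y'),
    forall u, enorm (q u) < 100 ->
      exists2 y, S y & enorm (y - x - q u) <= eps * enorm (q u) &
    forall y, enorm (y - x) < 199 ->
      (forall e : R, 0 < e -> exists2 s, S s & enorm (s - y) < e) -> S y].
Proof.
move=> [_ /(_ x)] flat e0 e1 Sx; have [V [F [dV perp C2 small graph]]] := flat Sx.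
have [q qV] := oproj_exists V; exists V, q.
have F_le y : plane x V y -> enorm (F y) <= eps /\
    forall v, v \in V -> enorm v <= 1 -> enorm ('D_v F y) <= eps.
  move=> Vy; have := small y Vy.
  have D1 : (0 <= normD1 V F y)%E.
    apply: (@le_trans _ _ (enorm ('D_0 F y))%:E); first by rewrite lee_fin.
    by apply: ereal_sup_ubound; exists 0 => //; split; [exact: mem0v|rewrite enorm0].
  have D2 : (0 <= normD2 V F y)%E.
    apply: (@le_trans _ _ (enorm ('D_0 ('D_0 F) y))%:E); first by rewrite lee_fin.
    apply: ereal_sup_ubound; exists (0, 0) => //.
    by split; split; rewrite ?mem0v ?enorm0.
  move=> h; split.
    rewrite -lee_fin; apply: le_trans h; rewrite -addeA leeDl //.
    exact: adde_ge0.
  move=> v vV v1; rewrite -lee_fin.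
  apply: (@le_trans _ _ (normD1 V F y)); first by apply: ereal_sup_ubound; exists v.
  by apply: le_trans h; rewrite -addeA addeCA leeDl // adde_ge0 // lee_fin.
have F_lip y y' : plane x V y -> plane x V y' -> enorm (F y - F y') <= eps * enorm (y - y').
  apply: plane_lipschitz => {}y Vy; last exact: (F_le y Vy).2.
  by move=> v vV; have [_ h] := C2; have [h' _] := h v vV; exact: h'.
have line u : plane x V (x + q u).
  by rewrite /plane /= addrC addKr; exact: qV.1.
have qF y : plane x V y -> q (F y) = 0.
  move=> Vy; apply: enorm_eq0; apply/eqP; rewrite -sqrf_eq0 enorm_sqr.
  by rewrite oproj_sym oprojK perp // qV.1.
have graphE y : enorm (y - x) < 200 -> S y <-> y = x + q (y - x) + F (x + q (y - x)).
  move=> yx; split.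
    move=> Sy; have : (S `&` eball x 200) y by [].
    rewrite graph => -[[z Vz zE] _].
    have -> : x + q (y - x) = z; last by [].
    rewrite -zE (_ : z + F z - x = (z - x) + F z); last by vec.
    by rewrite linearD qF // addr0 qV.2 //; vec.
  move=> yE; have : ([set z + F z | z in plane x V] `&` eball x 200) y.
    by split => //; exists (x + q (y - x)).
  by rewrite -graph => -[].
(* [x] is the graph point over its own projection. *)
have Fx : F x = 0.
  have xx : enorm (x - x) < 200 by rewrite subrr enorm0; lra.
  have := (graphE x xx).1 Sx; rewrite subrr linear0 addr0 => h.
  by rewrite -[F x](addKr x) -h addNr.
split => //.
- move=> y y' Sy Sy' yx y'x.
  have -> : y - y' - q (y - y') = F (x + q (y - x)) - F (x + q (y' - x)).
    have -> : q (y - y') = q (y - x) - q (y' - x) by rewrite -linearB; congr (q _); vec.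
    by rewrite {1}((graphE y yx).1 Sy) {1}((graphE y' y'x).1 Sy'); vec.
  apply: le_trans (F_lip _ _ (line _) (line _)) _; rewrite ler_wpM2l //.
  have -> : x + q (y - x) - (x + q (y' - x)) = q (y - y').
    rewrite (_ : y - y' = (y - x) - (y' - x)); last by vec.
    by rewrite [RHS]linearB; vec.
  exact: oproj_contract.
- move=> u qu; have Vu := line u.
  have Vx : plane x V x by rewrite /plane /= subrr mem0v.
  have h := F_lip _ _ Vu Vx; rewrite Fx subr0 (_ : x + q u - x = q u) in h; last by vec.
  have yE : x + q u + F (x + q u) - x = q u + F (x + q u) by vec.
  exists (x + q u + F (x + q u)); last by rewrite yE addrC addKr.
  apply/graphE.
    rewrite yE; apply: le_lt_trans (ler_enormD _ _) _.
    by have [h' _] := F_le _ Vu; lra.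
  by rewrite yE linearD oprojK qF // addr0.
- move=> y yx adh; apply/graphE; first by lra.
  apply/eqP; rewrite -subr_eq0; apply/eqP/enorm_eq0/eqP.
  rewrite eq_le enorm_ge0 andbT; apply/ler_addgt0Pr => e egt0; rewrite add0r.
  have [|s Ss sy] := adh (Num.min (e / 3) 1); first by rewrite lt_min ltr01 divr_gt0.
  move: sy; rewrite lt_min => /andP[sy sy1].
  have sx : enorm (s - x) < 200 by have := enorm_triangle s y x; lra.
  have hF := F_lip _ _ (line (y - x)) (line (s - x)).
  have qE : x + q (y - x) - (x + q (s - x)) = q (y - s).
    rewrite (_ : y - s = (y - x) - (s - x)); last by vec.
    by rewrite [RHS]linearB; vec.
  have qc := oproj_contract q (y - s); rewrite enormBC in sy.
  rewrite qE in hF.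
  have {}hF : enorm (F (x + q (y - x)) - F (x + q (s - x))) <= enorm (y - s).
    apply: le_trans hF _; apply: le_trans _ qc; rewrite ler_piMl //.
  have -> : y - (x + q (y - x) + F (x + q (y - x))) =
      (y - s) - q (y - s) - (F (x + q (y - x)) - F (x + q (s - x))).
    have h : F (x + q (s - x)) = s - (x + q (s - x)).
      by rewrite {2}((graphE s sx).1 Ss) addrAC subrr add0r.
    by rewrite h -qE; vec.
  have := ler_enormB (y - s - q (y - s)) (F (x + q (y - x)) - F (x + q (s - x))).
  by have := ler_enormB (y - s) (q (y - s)); lra.
Qed.

End FlatModel.

(** A point [x] of [S] is only known to be within 6/10 of some [z] in [E]. Since [E] is close to
    [S], the plane of scale 1 at [z] is nearly parallel to the model plane at [x] and passes within
    [O(eps)] of [x]; [E] has a point close to that spot. *)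
Lemma first_stage (R : realType) (n d : nat) (E U S : set 'rV[R]_n) (eps b : R)
    (p : 'rV[R]_n -> R -> oproj R n) :
  flat_at_scales E U eps p ->
  (forall (z : 'rV[R]_n) (r : R), E z -> nbd U 2 z -> 0 < r -> r <= 1 ->
    exists V, \dim V = d /\ oproj_on (p z r) V) ->
  flat_model_surface d eps S ->
  (forall x, E x -> nbd U 2 x -> exists2 s, S s & enorm (x - s) <= 2 * eps) ->
  (forall x, S x -> nbd U 2 x -> exists2 z, E z & enorm (x - z) <= 6 / 10) ->
  0 < eps -> eps <= 1 / 40 / 50 -> 80 * (80 * eps) <= b ->
  stage E U p b (1 / 20) S.
Proof.
move=> flat pdim model ES SE e0 e1 eb.
have eps0 := ltW e0.
have eps1 : eps <= 1 by lra.
have compare (x z : 'rV[R]_n) (rho : R) (V : {vspace 'rV[R]_n}) q : S x ->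
    \dim V = d -> oproj_on q V ->
    (forall y y', S y -> S y' -> enorm (y - x) < 200 -> enorm (y' - x) < 200 ->
      enorm ((y - y') - q (y - y')) <= eps * enorm (y - y')) ->
    E z -> nbd U (3 / 2) z -> enorm (x - z) <= 1 -> 1 / 20 <= rho -> rho <= 1 ->
    forall u, enorm (p z rho u - q u) <= 3 * (20 * (7 * eps)) * enorm u.
  move=> Sx dV qV qS Ez Uz xz rho0 rho1.
  have Uz2 : nbd U 2 z by apply: nbd_le Uz _; lra.
  have r0 : 0 < rho by lra.
  have [W [dW pW]] := pdim z rho Ez Uz2 r0 rho1.
  have [_ h2] := flat z rho Ez Uz2 r0 rho1.
  have [sz Ssz zsz] := ES z Ez Uz2.
  (* Three distances of at most [2 eps] plus the slope [eps], relative to the length 1/20. The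
     reverse gap comes from equality of dimensions and doubles the constant. *)
  have k140 : oproj_le (20 * (7 * eps)) (p z rho) q.
    apply: (@oproj_le_scale _ _ _ (1 / 20)); first by lra.
    move=> u pu u1; have [|e Ee] := h2 u; first by rewrite pu; lra.
    rewrite pu => ze.
    have er : eps * rho <= eps by rewrite ler_piMr.
    have Ue : nbd U 2 e.
      apply: (nbd_shift Uz (_ : _ <= 1 / 2)); last by lra.
      have -> : e - z = u - (z + u - e) by vec.
      by have := ler_enormB u (z + u - e); clear -u1 ze er e1; lra.
    have [s Ss es] := ES e Ee Ue.
    have g0 : enorm (u - (s - sz)) <= 6 * eps.
      have -> : u - (s - sz) = (z + u - e) + (e - s) - (z - sz) by vec.
      have := ler_enormB (z + u - e + (e - s)) (z - sz).
      have := ler_enormD (z + u - e) (e - s); clear -ze er es zsz; lra.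
    have g1 : enorm (s - sz) <= 1.
      by have := lerB_enorm (s - sz) u; rewrite (enormBC (s - sz)); clear -g0 u1 e1; lra.
    have szx1 : enorm (sz - x) < 100.
      by have := enorm_triangle x z sz; rewrite (enormBC sz); clear -zsz xz e1; lra.
    have sx : enorm (s - x) < 200.
      by have := enorm_triangle s sz x; clear -g1 szx1; lra.
    have szx : enorm (sz - x) < 200 by clear -szx1; lra.
    have g2 := qS s sz Ss Ssz sx szx.
    have : eps * enorm (s - sz) <= eps by rewrite ler_piMr.
    have := oproj_res_le q u (s - sz); clear -g0 g2; lra.
  have k280 : oproj_le (2 * (20 * (7 * eps))) q (p z rho).
    by apply: (oproj_le_sym pW qV) => //; [rewrite dW dV|lra|lra].
  have -> : 3 * (20 * (7 * eps)) = 20 * (7 * eps) + 2 * (20 * (7 * eps)) by ring.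
  move=> u.
  by apply: oproj_dist => //; lra.
have r10 : 10 * (1 / 20) = 1 / 2 :> R by field.
split; rewrite ?r10.
- move=> x Sx Ux; have [V [q [dV qV qS _ _]]] := flat_model_local model eps0 eps1 Sx.
  have [|z Ez xz] := SE x Sx; first by apply: nbd_le Ux _; lra.
  have Uz : nbd U (3 / 2) z by apply: (nbd_shift Ux (_ : _ <= 6 / 10)); [rewrite enormBC|lra].
  have Uz2 : nbd U 2 z by apply: nbd_le Uz _; lra.
  have xz1 : enorm (x - z) <= 1 by lra.
  have i20 : 1 / 20 <= 1 :> R by lra.
  have pq := compare x z 1 V q Sx dV qV qS Ez Uz xz1 i20 (lexx _) (x - z).
  have [sz Ssz zsz] := ES z Ez Uz2.
  have g0 : enorm (x - sz) <= 1.
    by have := enorm_triangle x z sz; lra.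
  have g1 : enorm (x - sz - q (x - sz)) <= eps * enorm (x - sz).
    by apply: qS => //; [rewrite subrr enorm0; lra|rewrite enormBC; lra].
  have g2 := oproj_res_le q (x - z) (x - sz).
  rewrite (_ : x - z - (x - sz) = - (z - sz)) in g2; last by vec.
  rewrite enormN in g2.
  have g3 : eps * enorm (x - sz) <= eps by rewrite ler_piMr.
  have [_ h2] := flat z 1 Ez Uz2 ltr01 (lexx _).
  have pc := oproj_contract (p z 1) (x - z).
  have [|e Ee ze] := h2 (x - z); first by clear -pc xz1; lra.
  exists e => //.
  have -> : x - e = (x - z - q (x - z)) - (p z 1 (x - z) - q (x - z)) + (z + p z 1 (x - z) - e).
    by vec.
  have := ler_enormD ((x - z - q (x - z)) - (p z 1 (x - z) - q (x - z))) (z + p z 1 (x - z) - e).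
  have := ler_enormB (x - z - q (x - z)) (p z 1 (x - z) - q (x - z)).
  have : 3 * (20 * (7 * eps)) * enorm (x - z) <= 3 * (20 * (7 * eps)) * (6 / 10).
    by rewrite ler_wpM2l // !mulr_ge0.
  clear -g1 g2 g3 ze pq zsz eb eps0 xz; lra.
- move=> x x' z Sx Sx' Ux Ux' xx' Ez zx.
  have [V [q [dV qV qS _ _]]] := flat_model_local model eps0 eps1 Sx.
  have Uz : nbd U (3 / 2) z by apply: nbd_shift Ux zx _; lra.
  have xz1 : enorm (x - z) <= 1 by rewrite enormBC; lra.
  have i20 : 1 / 20 <= 1 :> R by lra.
  have pq := compare x z (1 / 20) V q Sx dV qV qS Ez Uz xz1 (lexx _) i20 (x - x').
  have g1 : enorm (x - x' - q (x - x')) <= eps * enorm (x - x').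
    by apply: qS => //; [rewrite subrr enorm0; lra|rewrite enormBC; lra].
  have -> : x - x' - p z (1 / 20) (x - x') =
      (x - x' - q (x - x')) - (p z (1 / 20) (x - x') - q (x - x')) by vec.
  have := ler_enormB (x - x' - q (x - x')) (p z (1 / 20) (x - x') - q (x - x')).
  have : (3 * (20 * (7 * eps)) + eps) * enorm (x - x') <= b * enorm (x - x').
    by rewrite ler_wpM2r //; clear -eb eps0; lra.
  clear -g1 pq; lra.
- move=> x z u Sx Ux Ez zx; set w := p z _ u => wr.
  have [V [q [dV qV qS qfull _]]] := flat_model_local model eps0 eps1 Sx.
  have Uz : nbd U (3 / 2) z by apply: nbd_shift Ux zx _; lra.
  have xz1 : enorm (x - z) <= 1 by rewrite enormBC; lra.
  have i20 : 1 / 20 <= 1 :> R by lra.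
  have := compare x z (1 / 20) V q Sx dV qV qS Ez Uz xz1 (lexx _) i20 w.
  rewrite {1}/w oprojK -/w => pq.
  have qw := oproj_contract q w.
  have [|y Sy yx] := qfull w; first by lra.
  exists y => //; rewrite (_ : y - x - w = (y - x - q w) - (w - q w)); last by vec.
  have := ler_enormB (y - x - q w) (w - q w).
  have : eps * enorm (q w) <= eps * enorm w by rewrite ler_wpM2l.
  have : (3 * (20 * (7 * eps)) + eps) * enorm w <= 1 / 2 * enorm w.
    by rewrite ler_wpM2r //; clear -e1 eps0; lra.
  clear -yx pq; lra.
- move=> z Ez Uz; have [|s Ss zs] := ES z Ez; first by apply: nbd_le Uz _; lra.
  by exists s => //; rewrite enormBC; lra.
Qed.

(** * The construction of the map *)

Section Closure.
Variables (R : realType) (n : nat).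

Lemma closureP (A : set 'rV[R]_n) (x : 'rV[R]_n) :
  closure A x <-> forall e : R, 0 < e -> exists2 z, A z & enorm (z - x) < e.
Proof.
split=> [clA e e0|h B /nbhs_ballP[e /= e0 eB]].
  (* Dividing by [n + 1] instead of [n] makes the final inequality strict and covers [n = 0]. *)
  have n0 : 0 < n.+1%:R :> R by rewrite ltr0n.
  have /clA[z [Az]] : nbhs x (ball x (e / n.+1%:R)).
    by apply: nbhsx_ballx; rewrite divr_gt0.
  rewrite -ball_normE /= => zx; exists z => //.
  apply: le_lt_trans (_ : n%:R * (e / n.+1%:R) < _).
    apply: enorm_le_coord => i; apply: ltW; apply: le_lt_trans zx.
    rewrite /Num.Def.normr /= mx_normrE; apply: le_trans (le_bigmax _ _ (ord0, i)).
    by rewrite !mxE /= distrC.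
  by rewrite mulrCA gtr_pMr // ltr_pdivrMr // mul1r ltr_nat.
have [z Az zx] := h e e0; exists z; split => //; apply: eB.
rewrite -ball_normE /=; apply: le_lt_trans zx.
rewrite /Num.Def.normr /= mx_normrE; apply: bigmax_le => // -[i j] _.
by rewrite ord1 enormBC; exact: le_coord_enorm.
Qed.

End Closure.

Section Iteration.
Variables (R : realType) (n : nat) (E U Sigma : set 'rV[R]_n) (eps : R).
Variable p : 'rV[R]_n -> R -> oproj R n.

(** A displacement is chosen for every pair of a set and a scale at once, with default 0 when the
    pair is not a stage; the sequence is then a plain recursion. *)
Lemma iteration (I : finType) (L b : R) : (0 < n)%N -> 
  (forall r : R, 0 < r ->
    exists (theta : I -> 'rV[R]_n -> R) (ctr : I -> 'rV[R]_n -> 'rV[R]_n),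
    [/\ forall c y, 0 <= theta c y, forall y, \sum_c theta c y = 1,
        forall c y, enorm (ctr c y - y) <= r / 2 &
        forall c y y',
          ctr c y = ctr c y' /\ `|theta c y - theta c y'| <= L / r * enorm (y - y') \/
          theta c y <= L / r * enorm (y - y') /\ theta c y' <= L / r * enorm (y - y')]) ->
  0 <= L -> flat_at_scales E U eps p -> 0 < eps ->
  42 * eps <= b -> 2 * (#|I|%:R * (12 + 38 * L) * eps) + 12 * eps <= b ->
  4 * n%:R * b <= 1 / 100 ->
  stage E U p b (1 / 20) Sigma ->
  exists v : nat -> 'rV[R]_n -> 'rV[R]_n,
    [/\ forall k x, enorm (v k x) <= 4 * n%:R * b * stage_scale R k,
        forall k, lipschitz_by (4 * n%:R * b) (v k),
        forall k x, ~ nbd U (10 * stage_scale R k) x -> v k x = 0 &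
        forall k, stage E U p b (stage_scale R k) [set flow v k x | x in Sigma]].
Proof.
move=> n0 pu L0 flat e0 eb Kb nb st0; set eta := 4 * n%:R * b.
have b0 : 0 <= b by lra.
have n1 : 1 <= n%:R :> R by rewrite ler1n.
have bn : b <= n%:R * b by rewrite ler_peMl.
have K0 : 0 <= #|I|%:R * (12 + 38 * L) * eps.
  by rewrite mulr_ge0 ?(ltW e0) // mulr_ge0 // addr_ge0 // mulr_ge0.
have step (Sr : set 'rV[R]_n * R) : exists v : 'rV[R]_n -> 'rV[R]_n,
    0 < Sr.2 -> Sr.2 <= 1 / 20 -> stage E U p b Sr.2 Sr.1 ->
    [/\ forall x, enorm (v x) <= eta * Sr.2, lipschitz_by eta v,
        forall x, ~ nbd U (10 * Sr.2) x -> v x = 0 &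
        stage E U p b (Sr.2 / 2) [set y + v y | y in Sr.1]].
  case: Sr => S r /=.
  have [[r0 r1 st]|no] := EM [/\ 0 < r, r <= 1 / 20 & stage E U p b r S]; last first.
    by exists (fun=> 0) => r0 r1 st; case: no.
  have [theta [ctr [th0 th1 ctrc thl]]] := pu r r0.
  have [||v [h [vs vl vo vh [hf hl]]]] :=
    stage_displacement n0 flat e0 eb _ _ r0 r1 L0 th0 th1 ctrc thl st.
  - by lra.
  - by lra.
  exists v => _ _ _; split => //.
  by apply: (stage_next flat e0 eb _ nb Kb K0 r0 r1 st vs vl vh hf hl); lra.
have [V VP] := choice step.
pose S := fix S k :=
  if k is k'.+1 then [set y + V (S k', stage_scale R k') y | y in S k'] else Sigma.
have stS k : stage E U p b (stage_scale R k) (S k).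
  elim: k => [|k IH]; first by rewrite /stage_scale expr0.
  rewrite stage_scaleS.
  by have [] := VP (S k, stage_scale R k) (stage_scale_gt0 _ _) (stage_scale_le _ _) IH.
pose v k := V (S k, stage_scale R k).
have vP k := VP (S k, stage_scale R k) (stage_scale_gt0 _ _) (stage_scale_le _ _) (stS k).
have SE k : S k = [set flow v k x | x in Sigma].
  elim: k => [|k IH]; first by rewrite /= image_id.
  apply/seteqP; split=> [_ [y Sy <-]|_ [x Sx <-]] /=.
    have [x Sx <-] : [set flow v k x | x in Sigma] y by rewrite -IH.
    by exists x.
  by exists (flow v k x) => //; rewrite IH; exists x.
exists v; split => [k|k|k|k]; try by have [] := vP k.
by rewrite -SE.
Qed.

End Iteration.

Lemma planes_of_hypothesis (R : realType) (n d : nat) (E U : set 'rV[R]_n) (eps : R) :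
  0 < eps ->
  (forall (x : 'rV[R]_n) (r : R), (E `&` Uplus U) x -> 0 < r -> r <= 1 ->
     exists V : {vspace 'rV[R]_n},
       [/\ \dim V = d,
           forall y, (E `&` eball x (110 * r)) y ->
             (dist y (plane x V) <= (eps * r)%:E)%E
         & forall y, (plane x V `&` eball x (110 * r)) y ->
             (dist y E <= (eps * r)%:E)%E]) ->
  exists p : 'rV[R]_n -> R -> oproj R n, flat_at_scales E U eps p /\
    forall (z : 'rV[R]_n) (r : R), E z -> nbd U 2 z -> 0 < r -> r <= 1 ->
      exists V, \dim V = d /\ oproj_on (p z r) V.
Proof.
move=> e0 H.
have sel (zr : 'rV[R]_n * R) : exists q : oproj R n,
    E zr.1 -> nbd U 2 zr.1 -> 0 < zr.2 -> zr.2 <= 1 ->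
    [/\ exists V, \dim V = d /\ oproj_on q V,
        forall y, E y -> enorm (y - zr.1) < 110 * zr.2 ->
          enorm ((y - zr.1) - q (y - zr.1)) <= eps * zr.2 &
        forall u, enorm (q u) < 110 * zr.2 ->
          exists2 e, E e & enorm (zr.1 + q u - e) <= 2 * (eps * zr.2)].
  case: zr => z r /=; have [q0 _] := oproj_exists (fullv : {vspace 'rV[R]_n}).
  have [[Ez Uz r0 r1]|no] := EM [/\ E z, nbd U 2 z, 0 < r & r <= 1]; last first.
    by exists q0 => Ez Uz r0 r1; case: no.
  have [|//|//|V [dV EV VE]] := H z r; first by split => //; exact: nbd_dist.
  have [q qV] := oproj_exists V; exists q => _ _ _ _; split.
  - by exists V.
  - by move=> y Ey yz; apply: (dist_plane_res qV); apply: EV.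
  - move=> u qu; have [||e Ee ze] := dist_lt (r' := 2 * (eps * r)) (VE (z + q u) _).
    + split; first by rewrite /plane /= addrC addKr; exact: qV.1.
      by rewrite /eball /= addrC addKr.
    + by have := mulr_gt0 e0 r0; lra.
    by exists e => //; exact: ltW.
have [P PP] := choice sel; exists (fun z r => P (z, r)); split => z r Ez Uz r0 r1.
  by have [_ h1 h2] := PP (z, r) Ez Uz r0 r1.
by have [h _ _] := PP (z, r) Ez Uz r0 r1.
Qed.

Lemma limit_surface (R : realType) (n d : nat) (E U Sigma : set 'rV[R]_n) (eps eta b : R)
    (p : 'rV[R]_n -> R -> oproj R n) (v : nat -> 'rV[R]_n -> 'rV[R]_n) :
  (0 < n)%N -> flat_model_surface d eps Sigma -> 0 <= eps -> eps <= 1 ->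
  0 <= eta -> n%:R * (n%:R * eta) <= 1 / 100 -> 0 <= b -> b <= 1 ->
  (forall k x, enorm (v k x) <= eta * stage_scale R k) ->
  (forall k, lipschitz_by eta (v k)) ->
  (forall k x, ~ nbd U (10 * stage_scale R k) x -> v k x = 0) ->
  (forall k, stage E U p b (stage_scale R k) [set flow v k x | x in Sigma]) ->
  exists g : 'rV[R]_n -> 'rV[R]_n,
    [/\ bijective g,
        forall x, ~ nbd U 1 x -> g x = x,
        forall x, enorm (g x - x) <= 6 * (n%:R * eta),
        forall x x' : 'rV[R]_n, enorm (x' - x) <= 1 ->
          1 / 4 * enorm (x' - x) `^ (1 + 6 * (n%:R * eta)) <= enorm (g x' - g x) /\
          enorm (g x' - g x) <= 3 * enorm (x' - x) `^ (1 - 6 * (n%:R * eta))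
      & closure E `&` U = (g @` Sigma) `&` U].
Proof.
move=> n0 model eps0 eps1 eta0 NNeta b0 b1 vs vl vo vst.
pose N : R := n%:R; have N1 : 1 <= N by rewrite ler1n.
have N0 : 0 <= N by apply: le_trans N1.
have Neta : N * eta <= 1 / 100 by apply: le_trans NNeta; rewrite ler_peMl // mulr_ge0.
have eta1 : eta <= 1 / 100 by apply: le_trans Neta; rewrite ler_peMl.
have [g gP] := limit_exists n0 eta0 Neta vs.
have gbij := limit_bij n0 eta0 Neta vs vl gP.
have s0 := stage_scale_gt0 R; have s1 := stage_scale_le R.
have gk x k : enorm (flow v k x - g x) <= stage_scale R k.
  apply: le_trans (gP x k) _; rewrite -/N.
  rewrite (_ : N * _ = 2 * (N * eta) * stage_scale R k); last by ring.
  by rewrite ler_piMl ?ltW //; lra.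
have sgeom k : stage_scale R k <= 1 / 20 * (2 / 3) ^+ k.
  have : (1 / 2) ^+ k <= (2 / 3) ^+ k :> R by apply: lerXn2r; rewrite ?nnegrE; lra.
  by rewrite /stage_scale; lra.
have small (e : R) : 0 < e -> exists k, 3 * (1 / 20 * (2 / 3) ^+ k) < e.
  move=> ep; apply: contrapT => /forallNP nk; have : e <= 0; last by lra.
  apply: (@le_geometric_le0 _ e (3 * (1 / 20)) (2 / 3)); try lra.
  by move=> k; have := nk k => /negP; rewrite -leNgt mulrA.
exists g; split => //.
- move=> x xU; have far k : ~ nbd U (10 * stage_scale R k) x.
    by move=> /nbd_le xU'; apply: xU; apply: xU'; have := s1 k; clear; lra.
  have fx k : flow v k x = x by elim: k => //= k ->; rewrite vo // addr0.
  apply/eqP; rewrite -subr_eq0; apply/eqP/enorm_eq0/eqP.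
  rewrite eq_le enorm_ge0 andbT; apply: (@le_geometric_le0 _ _ (1 / 20) (2 / 3)); try lra.
  by move=> k; apply: le_trans (sgeom k); rewrite enormBC -{1}(fx k).
- move=> x; have := gP x 0; rewrite /= enormBC /stage_scale expr0 -/N => h.
  apply: le_trans h _; rewrite (_ : N * _ = (N * eta) / 10); last by field.
  have : 0 <= N * eta by rewrite mulr_ge0.
  by clear; lra.
(* The Hölder bound is applied with [N * eta] in place of [eta]: exponents and displacement then
   share one constant. *)
- move=> x x' xx'; have eta'0 : 0 <= N * eta by rewrite mulr_ge0.
  have eta_le : eta <= N * eta by rewrite ler_peMl.
  have vl' k : lipschitz_by (N * eta) (v k).
    by move=> y y'; apply: le_trans (vl k y y') _; rewrite ler_wpM2r.
  have gP' y k : enorm (flow v k y - g y) <= N * (2 * (N * eta) * stage_scale R k).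
    apply: le_trans (gP y k) _; rewrite -/N ler_wpM2l // ler_wpM2r ?(ltW (s0 k)) //.
    by rewrite ler_wpM2l.
  exact: (limit_holder n0 eta'0 NNeta vl' gP' xx').
apply/seteqP; split => x [].
- move=> /closureP clx Ux; split => //.
  have [f _ gf] := gbij; pose y := f x; have gy : g y = x by exact: gf.
  (* The point of stage [k] that covers [E] near [x] is within [3 r_k] of the image of [y]; pulling
     back through the flow costs at most [(4/3)^k]. So [y] is adherent to [Sigma], which is closed
     near [y]. *)
  have approx k : exists2 s, Sigma s & enorm (s - y) <= 3 * (1 / 20 * (2 / 3) ^+ k).
    have rk := s0 k; have [z Ez zx] := clx _ rk.
    have [|_ [s Ss <-] sz] := stage_cover (vst k) Ez.
      by exists x => //; lra.
    exists s => //.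
    have h1 := gk y k; rewrite gy in h1.
    have h2 := enorm_triangle (flow v k s) z (flow v k y).
    have h3 := enorm_triangle z x (flow v k y); rewrite (enormBC x) in h3.
    have h4 := flow_lower n0 eta0 Neta vl k s y.
    have e34 : 0 < (3 / 4) ^+ k :> R by rewrite exprn_gt0 //; lra.
    have h5 : (3 / 4) ^+ k * enorm (s - y) <= (1 - eta) ^+ k * enorm (s - y).
      by rewrite ler_wpM2r //; apply: lerXn2r; rewrite ?nnegrE; lra.
    rewrite -(ler_pM2l e34); apply: le_trans h5 _; apply: le_trans h4 _.
    apply: (@le_trans _ _ (3 * stage_scale R k)); first by lra.
    rewrite /stage_scale (_ : 1 / 2 = 3 / 4 * (2 / 3)); last by field.
    by rewrite exprMn; lra.
  exists y => //.
  have [s Ss sy] := approx 0%N.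
  have [V [q [_ _ _ _ adh]]] := flat_model_local model eps0 eps1 Ss.
  apply: adh; first by rewrite enormBC; move: sy; rewrite expr0; lra.
  move=> e ep; have [k hk] := small e ep; have [s' Ss' s'y] := approx k.
  by exists s' => //; exact: le_lt_trans s'y hk.
- move=> [s Ss gs] Ux; split => //; apply/closureP => e ep.
  have [k hk] := small e ep; have h1 := gk s k; rewrite gs in h1.
  have rk := s0 k; have sk := sgeom k.
  have [||z Ez sz] := stage_near (vst k) (x := flow v k s).
  - by exists s.
  - by exists x => //; lra.
  exists z => //; have := enorm_triangle z (flow v k s) x; rewrite (enormBC z (flow v k s)).
  have : b * stage_scale R k <= 1 * stage_scale R k by rewrite ler_wpM2r // ltW.
  lra.
Qed.

Theorem theorem12p3 (R : realType) (n d : nat) (hd : (0 < d)%N)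
    (hdn : (d < n)%N) :
  exists eps0 C : R, 0 < eps0 /\ 1 <= C /\
  forall (eps : R) (E U Sigma0 : set 'rV[R]_n),
    0 < eps -> eps <= eps0 ->
    flat_model_surface d eps Sigma0 ->
    (forall x, (E `&` Uplus U) x -> (dist x Sigma0 <= eps%:E)%E) ->
    (forall x, (Sigma0 `&` Uplus U) x -> (dist x E <= (1 / 2)%:E)%E) ->
    (forall (x : 'rV[R]_n) (r : R), (E `&` Uplus U) x -> 0 < r -> r <= 1 ->
       exists V : {vspace 'rV[R]_n},
         [/\ \dim V = d,
             forall y, (E `&` eball x (110 * r)) y ->
               (dist y (plane x V) <= (eps * r)%:E)%E
           & forall y, (plane x V `&` eball x (110 * r)) y ->
               (dist y E <= (eps * r)%:E)%E]) ->
    exists g : 'rV[R]_n -> 'rV[R]_n,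
      [/\ bijective g,
          forall x, (13%:E <= dist x U)%E -> g x = x,
          forall x, enorm (g x - x) <= C * eps,
          forall x x' : 'rV[R]_n, enorm (x' - x) <= 1 ->
            1 / 4 * enorm (x' - x) `^ (1 + C * eps) <= enorm (g x' - g x) /\
            enorm (g x' - g x) <= 3 * enorm (x' - x) `^ (1 - C * eps)
        & closure E `&` U = (g @` Sigma0) `&` U].
Proof.
have n0 : (0 < n)%N by apply: leq_ltn_trans hdn.
have [I [L [L0 pu]]] := partition_of_unity R n0.
have N1 : 1 <= n%:R :> R by rewrite ler1n.
have K0 : 0 <= #|I|%:R * (12 + 38 * L).
  by rewrite mulr_ge0 // addr_ge0 // mulr_ge0.
(* [b = B eps] bounds the slope of the approximating surfaces, and their distance to [E] relative
   to the scale: the first term of [B] serves [first_stage], the other ones [iteration]. *)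
pose B := 80 * 80 + 12 + 2 * (#|I|%:R * (12 + 38 * L)).
have B1 : 80 * 80 <= B by rewrite /B; lra.
have B0 : 0 < B by lra.
(* The three factors [N] come from the extension, from the coordinatewise limit, and from the use of
   [N * eta] in the Hölder bound. *)
pose N : R := n%:R; pose M := 4 * (N * N * N * B).
have NN : 1 <= N * N by rewrite -[1]mulr1 ler_pM.
have NNN : 1 <= N * N * N by rewrite -[1]mulr1 ler_pM.
have N0 : 0 <= N by lra.
have M0 : 0 < M by rewrite /M mulr_gt0 // mulr_gt0 //; lra.
exists (1 / (100 * M)), (24 * (N * N * B)); split; first by rewrite divr_gt0 // mulr_gt0.
split.
  have : B <= N * N * B by rewrite ler_peMl // ltW.
  lra.
move=> eps E U S e0 e1 model hE hS hP.
have Me : M * eps <= 1 / 100.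
  by move: e1; rewrite ler_pdivlMr ?mulr_gt0 //; lra.
pose b := B * eps; pose eta := 4 * N * b.
have b0 : 0 <= b by rewrite mulr_ge0 // ltW.
have etaM : N * (N * eta) = M * eps by rewrite /eta /b /M; ring.
have CE : 24 * (N * N * B) * eps = 6 * (N * eta) by rewrite /eta /b; ring.
have eta0 : 0 <= eta by rewrite /eta mulr_ge0 // mulr_ge0.
have Neta : N * eta <= 1 / 100.
  apply: le_trans Me; rewrite -etaM; apply: ler_wpM2l => //.
  by rewrite ler_peMl.
have eta1 : eta <= 1 / 100 by apply: le_trans Neta; rewrite ler_peMl.
have b4 : 4 * b <= eta.
  by rewrite /eta -mulrA ler_wpM2l // ler_peMl.
have be : 80 * 80 * eps <= b by rewrite ler_wpM2r // ltW.
have bK : b = 80 * 80 * eps + 12 * eps + 2 * (#|I|%:R * (12 + 38 * L) * eps).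
  by rewrite /b /B; ring.
have Ke0 : 0 <= #|I|%:R * (12 + 38 * L) * eps by rewrite mulr_ge0 // ltW.
have eps1 : eps <= 1 by lra.
have b1 : b <= 1 by lra.
have NNeta : N * (N * eta) <= 1 / 100 by rewrite etaM.
have [p [flat pdim]] := planes_of_hypothesis e0 hP.
have ES x : E x -> nbd U 2 x -> exists2 s, S s & enorm (x - s) <= 2 * eps.
  move=> Ex Ux; have [||s Ss xs] := dist_lt (r' := 2 * eps) (hE x _).
  - by split => //; exact: nbd_dist.
  - by lra.
  by exists s => //; exact: ltW.
have SE x : S x -> nbd U 2 x -> exists2 z, E z & enorm (x - z) <= 6 / 10.
  move=> Sx Ux; have [||z Ez xz] := dist_lt (r' := 6 / 10) (hS x _).
  - by split => //; exact: nbd_dist.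
  - by lra.
  by exists z => //; exact: ltW.
have st0 : stage E U p b (1 / 20) S.
  by apply: (first_stage flat pdim model ES SE e0); lra.
have [v [vs vl vo vst]] : exists v : nat -> 'rV[R]_n -> 'rV[R]_n,
    [/\ forall k x, enorm (v k x) <= eta * stage_scale R k,
        forall k, lipschitz_by eta (v k),
        forall k x, ~ nbd U (10 * stage_scale R k) x -> v k x = 0 &
        forall k, stage E U p b (stage_scale R k) [set flow v k x | x in S]].
  by apply: (iteration n0 pu L0 flat e0) => //; lra.
have [g [gbij gid gclose gholder gE]] :=
  limit_surface n0 model (ltW e0) eps1 eta0 NNeta b0 b1 vs vl vo vst.
exists g; split => //.
- move=> x xU; apply: gid => /nbd_dist /(le_trans xU); rewrite lee_fin; clear; lra.
- by move=> x; rewrite CE.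
- by move=> x x'; rewrite CE; exact: gholder.
Qed.
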